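(* Let $\mathcal L(t)$ and $\widetilde{\mathcal L}(t)$ be Mordell–Appell vectors related for $t\in\mathbb R^+$ by an $S$-transformation of the form $$\mathcal L(t)=\sqrt{\frac{\pi}{t}}\;M\,\widetilde{\mathcal L}\!\left(\frac{\pi^2}{t}\right),$$ with $M$ a constant matrix. Under this $S$-transformation, the median value on the Stokes line is mapped, up to the explicit weight-$1/2$ multiplier, to the Stokes jump of the $S$-dual integral.
   Context: Mordell–Appell vectors are vectors of (normalized) Mordell–Appell integrals, i.e. with entries given by $t^{1/2}$ times finite linear combinations of $JS_{(P,a)}(t)=\frac1t\int_0^\infty e^{-Pu^2/t}\frac{\sinh((P-a)u)}{\sinh(Pu)}du$ and $JC_{(P,a)}(t)=\frac1t\int_0^\infty e^{-Pu^2/t}\frac{\cosh((P-a)u)}{\cosh(Pu)}du$ ($\Re t>0$); by contour rotation these extend analytically to a sector of opening $3\pi$ centered on $\mathbb R^+$. The Stokes line is $t\in\mathbb R^-$. Denote the upper and lower lateral continuations to $\mathbb R^-$ by $\mathcal L^{\pi-}$ and $\mathcal L^{-\pi+}$, and set $$\mathcal L^{\rm med}=\tfrac12\bigl(\mathcal L^{\pi-}+\mathcal L^{-\pi+}\bigr)\ \text{(median value)},\qquad \operatorname{Jump}\mathcal L=\tfrac12\bigl(\mathcal L^{\pi-}-\mathcal L^{-\pi+}\bigr)\ \text{(Stokes jump)},$$ and likewise for the $S$-dual $\widetilde{\mathcal L}$. *)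

(* Defs.v *)
From Stdlib Require Import Reals ClassicalEpsilon.
From mathcomp Require Import all_boot.
From Coquelicot Require Import Coquelicot.

Set Implicit Arguments.
Unset Strict Implicit.
Unset Printing Implicit Defensive.

Open Scope R_scope.

Definition Cexp (z : C) : C := (exp (Re z) * cos (Im z), exp (Re z) * sin (Im z)).

(* The principal square root, by the half-angle formulas. It is only used on
   the half-plane 0 < Re z, where the divisor is positive. *)
Definition Csqrt (z : C) : C :=
  let r := sqrt ((Cmod z + Re z) / 2) in (r, Im z / (2 * r)).

Definition Csum (n : nat) (f : 'I_n -> C) : C := \big[Cplus/RtoC 0]_(j < n) f j.

Definition matvec (m n : nat) (M : 'I_m -> 'I_n -> C) (v : 'I_n -> C)
  (i : 'I_m) : C := Csum (fun j => (M i j * v j)%C).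

Definition Cint_0_oo (f : R -> C) : C :=
  RInt_gen (V := C_R_CompleteNormedModule) f (at_point 0) (Rbar_locally p_infty).

(* The quotient sinh/sinh takes a junk value at u = 0, which does not affect
   the integral. *)
Definition JS (P a : R) (t : C) : C :=
  (/ t * Cint_0_oo (fun u : R =>
     Cexp (- RtoC (P * u ^ 2) / t) * RtoC (sinh ((P - a) * u) / sinh (P * u))))%C.

Definition JC (P a : R) (t : C) : C :=
  (/ t * Cint_0_oo (fun u : R =>
     Cexp (- RtoC (P * u ^ 2) / t) * RtoC (cosh ((P - a) * u) / cosh (P * u))))%C.

Definition basic_Mordell_Appell (g : C -> C) : Prop :=
  exists P a : R, 0 < P /\ (g = JS P a \/ g = JC P a).

(* Only the values on the half-plane 0 < Re t matter. *)
Definition Mordell_Appell (f : C -> C) : Prop :=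
  exists (k : nat) (c : 'I_k -> C) (g : 'I_k -> C -> C),
    (forall l, basic_Mordell_Appell (g l)) /\
    (forall t : C, 0 < Re t ->
       f t = (Csqrt t * Csum (fun l => c l * g l t))%C).

Definition Mordell_Appell_vector (n : nat) (L : 'I_n -> C -> C) : Prop :=
  forall i, Mordell_Appell (L i).

Definition analytic_at (F : C -> C) (w0 : C) : Prop :=
  exists a : nat -> C,
    locally (T := C_UniformSpace) w0 (fun w : C =>
      is_pseries (K := C_AbsRing) (V := C_NormedModule) a (w - w0)%C (F w)).

(* A sector of opening larger than 2 pi lies on the Riemann surface of the
   logarithm. A point t of that surface is represented by w = log t, so that
   the sector of opening 3 pi centered on the positive axis is the strip
   |Im w| < 3 pi / 2. *)
Definition sector_continuation_of (f : C -> C) (F : C -> C) : Prop :=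
  (forall w : C, Rabs (Im w) < 3 * PI / 2 -> analytic_at F w) /\
  (forall w : C, Rabs (Im w) < PI / 2 -> F w = f (Cexp w)).

(* The continuation is unique when it exists, by the identity theorem. *)
Definition sector_continuation (f : C -> C) : C -> C :=
  epsilon (inhabits (fun _ : C => RtoC 0)) (sector_continuation_of f).

(* Lateral continuations to t < 0: log t is ln |t| + i pi from above and
   ln |t| - i pi from below. Both points are interior to the sector, so the
   lateral limits are the values there. *)
Definition upper_lateral (f : C -> C) (t : R) : C :=
  sector_continuation f (ln (- t), PI).
Definition lower_lateral (f : C -> C) (t : R) : C :=
  sector_continuation f (ln (- t), - PI).

Definition median_value (f : C -> C) (t : R) : C :=
  ((upper_lateral f t + lower_lateral f t) / 2)%C.
Definition Stokes_jump (f : C -> C) (t : R) : C :=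
  ((upper_lateral f t - lower_lateral f t) / 2)%C.

(* Main.v *)
(* In the variable [w = log t], the substitution [u = s e^(w/3)] rewrites a
   Mordell-Appell integral as a single absolutely convergent integral which is
   holomorphic on the whole strip [|Im w| < 3 pi / 2]: this is the contour
   rotation, with an angle that follows [w]. For real [w] it is only a dilation
   of the variable, so the identity theorem identifies it with the original
   integral where both are defined. Analyticity follows by integrating over [s]
   the Taylor coefficients of the integrand, which Cauchy's formula bounds
   uniformly. By the identity theorem again, the S-relation
   [e^(w/2) F(w) = sqrt pi M Ft(2 ln pi - w)], known for real [w], holds on the
   strip. Exchanging [w = ln |t| + i pi] and [ln |t| - i pi] while multiplying by
   [e^(-w/2) = -i |t|^(-1/2)], resp. [i |t|^(-1/2)], turns the half-sum of the
   lateral values of [F] into [i] times the half-difference of those of [Ft]. *)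
Require Import Defs.
From Stdlib Require Import Reals ClassicalEpsilon Lra Lia.
From mathcomp Require Import all_boot.
From Coquelicot Require Import Coquelicot.

Open Scope R_scope.

(** Analyticity means a power series at every point of the strip, so each value of the integration
    variable needs Cauchy's formula, with coefficient bounds that can be integrated afterwards.
    Cauchy's formula is obtained by shrinking a circle onto a point along a real parameter and
    differentiating under the integral sign, which is why derivatives are asked to be continuous.

    Two reductions leave a single kernel. The quotient of hyperbolic cosines is a sum of two
    quotients of hyperbolic sines over $\sinh(2Pu)$, so the Gaussian constant and the denominator's
    frequency are independent parameters. Every power of $t$, namely the prefactor $1/t$, the
    Jacobian of the substitution and the normalization $t^{1/2}$, is absorbed in one exponent of the
    kernel.

    The slope $1/3$ is forced: a slope $\beta$ reaches the half-opening $3\pi/2$ only if $|\beta|\le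
    1/3$, to avoid the poles, and $|2\beta-1|\le 1/3$, to keep the Gaussian decay. *)

(** * Elementary inequalities and neighbourhoods in terms of the modulus *)

Lemma Cmod_minus_sym (x y : C) : Cmod (x - y) = Cmod (y - x).
Proof. by rewrite -Cmod_opp; congr Cmod; ring. Qed.

Lemma Cmod_triangle3 (x y z : C) : Cmod (x - z) <= Cmod (x - y) + Cmod (y - z).
Proof.
  have -> : (x - z)%C = ((x - y) + (y - z))%C by ring.
  exact: Cmod_triangle.
Qed.

Lemma Cmod_sub_le (x y : C) : Cmod (x - y) <= Cmod x + Cmod y.
Proof. by rewrite -(Cmod_opp y); apply: Cmod_triangle. Qed.

Lemma Cmod_le_plus (x y : C) : Cmod x <= Cmod y + Cmod (x - y).
Proof.
  have {1}-> : x = (y + (x - y))%C by ring.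
  exact: Cmod_triangle.
Qed.

Lemma im_le_Cmod (z : C) : Rabs (Im z) <= Cmod z.
Proof. exact: (Rle_trans _ _ _ (Rmax_r _ _) (Rmax_Cmod z)). Qed.

Lemma Cmod_le_abs (z : C) : Cmod z <= Rabs (Re z) + Rabs (Im z).
Proof.
  have H1 := Rabs_pos (Re z); have H2 := Rabs_pos (Im z).
  apply: Rsqr_incr_0_var; last lra.
  have := Cmod2_alt z.
  rewrite /Rsqr -(pow2_abs (Re z)) -(pow2_abs (Im z)) => H.
  nra.
Qed.

Lemma locally_Cmod (z : C) (P : C -> Prop) :
  locally (T := C_UniformSpace) z P <->
  exists d : R, 0 < d /\ forall w, Cmod (w - z) < d -> P w.
Proof.
  split.
  - case=> [[d dp] H]; exists d; split=> // w Hw; apply: H.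
    exact: C_NormedModule_mixin_compat1.
  - case=> d [dp H].
    have s2 : 0 < sqrt 2 by apply: sqrt_lt_R0; lra.
    have dp' : 0 < d / sqrt 2 by apply: Rdiv_lt_0_compat.
    exists (mkposreal _ dp') => w Hw; apply: H.
    have := C_NormedModule_mixin_compat2 _ _ _ Hw => /=.
    have -> : sqrt 2 * (d / sqrt 2) = d by field; lra.
    by [].
Qed.

Lemma locally_R (x : R) (P : R -> Prop) :
  locally x P <-> exists d : R, 0 < d /\ forall y, Rabs (y - x) < d -> P y.
Proof.
  split.
  - by case=> [[d dp] H]; exists d.
  - by case=> d [dp H]; exists (mkposreal _ dp).
Qed.

(** * Continuity and complex differentiability *)

(** Stated over any uniform space, so that the same rules serve functions of a real variable, of a
    complex variable and of a pair of real variables. *)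
Definition ccont {T : UniformSpace} (f : T -> C) (x : T) : Prop :=
  forall eps, 0 < eps -> locally x (fun y => Cmod (f y - f x) < eps).

Section Ccont.
Context {T : UniformSpace}.
Implicit Types (f g : T -> C) (x : T).

Lemma ccont_const (c : C) x : ccont (fun _ => c) x.
Proof.
  move=> eps He; apply: filter_forall => y.
  have -> : (c - c)%C = 0 by ring.
  by rewrite Cmod_0.
Qed.

Lemma ccont_ext_loc f g x : locally x (fun y => f y = g y) -> ccont f x -> ccont g x.
Proof.
  move=> H Hf eps He.
  have Hx : f x = g x by apply: (locally_singleton _ _ H).
  apply: filter_imp (filter_and _ _ H (Hf eps He)) => y [<-].
  by rewrite Hx.
Qed.

Lemma ccont_plus f g x : ccont f x -> ccont g x -> ccont (fun y => f y + g y)%C x.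
Proof.
  move=> Hf Hg eps He.
  have He2 : 0 < eps / 2 by lra.
  apply: filter_imp (filter_and _ _ (Hf _ He2) (Hg _ He2)) => y [H1 H2].
  have -> : (f y + g y - (f x + g x))%C = ((f y - f x) + (g y - g x))%C by ring.
  apply: (Rle_lt_trans _ _ _ (Cmod_triangle _ _)); lra.
Qed.

Lemma ccont_mult f g x : ccont f x -> ccont g x -> ccont (fun y => f y * g y)%C x.
Proof.
  move=> Hf Hg eps He.
  set A := Cmod (f x); set B := Cmod (g x).
  have HA : 0 <= A by apply: Cmod_ge_0.
  have HB : 0 <= B by apply: Cmod_ge_0.
  pose e := Rmin 1 (eps / (A + B + 2)).
  have Hq : 0 < eps / (A + B + 2) by apply: Rdiv_lt_0_compat; lra.
  have Hep : 0 < e by apply: Rmin_glb_lt; lra.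
  apply: filter_imp (filter_and _ _ (Hf _ Hep) (Hg _ Hep)) => y [H1 H2].
  have -> : (f y * g y - f x * g x)%C =
    ((f y - f x) * (g y - g x) + (f y - f x) * g x + f x * (g y - g x))%C by ring.
  apply: (Rle_lt_trans _ _ _ (Cmod_triangle _ _)).
  have := Cmod_triangle ((f y - f x) * (g y - g x)) ((f y - f x) * g x).
  rewrite !Cmod_mult -/A -/B.
  have Hu := Cmod_ge_0 (f y - f x); have Hv := Cmod_ge_0 (g y - g x).
  have He1 : e <= 1 by apply: Rmin_l.
  have He2 : e * (A + B + 2) <= eps.
  { have : e <= eps / (A + B + 2) by apply: Rmin_r.
    move/(Rmult_le_compat_r (A + B + 2)); rewrite /Rdiv Rmult_assoc Rinv_l; lra. }
  move: (Cmod (f y - f x)) (Cmod (g y - g x)) H1 H2 Hu Hv => u v *.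
  nra.
Qed.

Lemma ccont_opp f x : ccont f x -> ccont (fun y => - f y)%C x.
Proof.
  move=> Hf eps He; apply: filter_imp (Hf eps He) => y.
  by rewrite -Cmod_opp; have -> : (- (f y - f x))%C = (- f y - - f x)%C by ring.
Qed.

Lemma ccont_minus f g x : ccont f x -> ccont g x -> ccont (fun y => f y - g y)%C x.
Proof. by move=> Hf Hg; apply: ccont_plus => //; apply: ccont_opp. Qed.

Lemma ccont_comp f (h : C -> C) x :
  ccont f x -> ccont h (f x) -> ccont (fun y => h (f y)) x.
Proof.
  move=> Hf Hh eps He.
  have /locally_Cmod [d [dp H]] := Hh eps He.
  by apply: filter_imp (Hf d dp) => y /H.
Qed.

Lemma ccont_neq0 f x : ccont f x -> f x <> 0 -> locally x (fun y => f y <> 0).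
Proof.
  move=> Hf /Cmod_gt_0 H0.
  apply: filter_imp (Hf _ H0) => y Hy E.
  move: Hy; rewrite E Cmod_minus_sym.
  have -> : (f x - 0)%C = f x by ring.
  lra.
Qed.

Lemma ccont_continuous_Re f x : ccont f x -> continuous (fun y => Re (f y)) x.
Proof.
  move=> Hf P [d Hd]; apply: filter_imp (Hf d (cond_pos d)) => y Hy.
  apply: Hd; rewrite /ball /= /AbsRing_ball /abs /minus /plus /opp /=.
  have := re_le_Cmod (f y - f x); rewrite re_plus re_opp => H.
  exact: (Rle_lt_trans _ _ _ H Hy).
Qed.

Lemma ccont_continuous f x :
  ccont f x <-> continuous (U := C_R_CompleteNormedModule) f x.
Proof.
  split.
  - move=> Hf P /locally_Cmod [d [dp Hd]].
    by apply: filter_imp (Hf d dp) => y /Hd.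
  - move=> Hf eps He.
    apply: (Hf (fun w => Cmod (w - f x) < eps)).
    by apply/locally_Cmod; exists eps.
Qed.

End Ccont.

Lemma ccont_id (z : C) : ccont (T := C_UniformSpace) (fun w => w) z.
Proof. by move=> eps He; apply/locally_Cmod; exists eps. Qed.

Lemma ccont_comp_R {T : UniformSpace} (f : R -> C) (h : T -> R) (x : T) :
  continuous h x -> ccont f (h x) -> ccont (fun y => f (h y)) x.
Proof. by move=> Hh Hf eps He; exact: (Hh _ (Hf eps He)). Qed.

Lemma ccont_RtoC {T : UniformSpace} (h : T -> R) (x : T) :
  continuous h x -> ccont (fun y => RtoC (h y)) x.
Proof.
  move=> Hh; apply: (ccont_comp_R RtoC h) => // eps He.
  apply/locally_R; exists eps; split=> // y Hy.
  by rewrite -RtoC_minus Cmod_R.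
Qed.

Lemma ccont_Cinv (z : C) : z <> 0 -> ccont (T := C_UniformSpace) Cinv z.
Proof.
  move=> Hz eps He.
  have Hm : 0 < Cmod z by apply/Cmod_gt_0.
  apply/locally_Cmod; exists (Rmin (Cmod z / 2) (eps * (Cmod z * Cmod z / 2))); split.
  { apply: Rmin_glb_lt; first lra.
    by apply: Rmult_lt_0_compat => //; nra. }
  move=> w Hw.
  have H1 : Cmod (w - z) < Cmod z / 2 by apply: (Rlt_le_trans _ _ _ Hw); apply: Rmin_l.
  have H2 : Cmod (w - z) < eps * (Cmod z * Cmod z / 2)
    by apply: (Rlt_le_trans _ _ _ Hw); apply: Rmin_r.
  have H3 : Cmod z / 2 < Cmod w.
  { have := Cmod_le_plus z w; rewrite Cmod_minus_sym; lra. }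
  have Hw0 : w <> 0 by apply/Cmod_gt_0; lra.
  have -> : (/ w - / z)%C = ((z - w) / (w * z))%C by field; split.
  rewrite Cmod_div; last exact: Cmult_neq_0.
  rewrite Cmod_mult Cmod_minus_sym.
  apply/Rlt_div_l; first by apply: Rmult_lt_0_compat; lra.
  apply: (Rlt_le_trans _ _ _ H2); apply: Rmult_le_compat_l; nra.
Qed.

(* Caratheodory's form of differentiability: the rules of calculus reduce to
   those for continuity. *)
Definition cdiff (f : C -> C) (z l : C) : Prop :=
  exists phi : C -> C, [/\ ccont (T := C_UniformSpace) phi z, phi z = l &
    locally (T := C_UniformSpace) z (fun w => (f w - f z = phi w * (w - z))%C)].

(** The version for paths, that is, for complex functions of a real variable. *)
Definition pdiff (g : R -> C) (t : R) (l : C) : Prop :=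
  exists phi : R -> C, [/\ ccont phi t, phi t = l &
    locally t (fun s => (g s - g t = phi s * RtoC (s - t))%C)].

Lemma cdiff_cont f z l : cdiff f z l -> ccont (T := C_UniformSpace) f z.
Proof.
  case=> phi [Hphi _ H].
  apply: (@ccont_ext_loc C_UniformSpace (fun w => f z + phi w * (w - z))%C).
  - by apply: filter_imp H => w <-; ring.
  - apply: ccont_plus; first exact: ccont_const.
    apply: ccont_mult => //; apply: ccont_minus; [exact: ccont_id | exact: ccont_const].
Qed.

Lemma pdiff_cont g t l : pdiff g t l -> ccont g t.
Proof.
  case=> phi [Hphi _ H].
  apply: (@ccont_ext_loc _ (fun s => g t + phi s * RtoC (s - t))%C).
  - by apply: filter_imp H => w <-; ring.
  - apply: ccont_plus; first exact: ccont_const.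
    apply: ccont_mult => //; apply: ccont_RtoC.
    apply: (continuous_minus (fun s : R => s)); [exact: continuous_id | exact: continuous_const].
Qed.

Lemma cdiff_const c z : cdiff (fun _ => c) z 0.
Proof.
  exists (fun _ => RtoC 0); split=> //; first exact: ccont_const.
  by apply: filter_forall => w; ring.
Qed.

Lemma cdiff_id z : cdiff (fun w => w) z 1.
Proof.
  exists (fun _ => RtoC 1); split=> //; first exact: ccont_const.
  by apply: filter_forall => w; ring.
Qed.

Lemma cdiff_plus f g z l m :
  cdiff f z l -> cdiff g z m -> cdiff (fun w => f w + g w)%C z (l + m)%C.
Proof.
  case=> [p [p1 p2 p3]] [q [q1 q2 q3]].
  exists (fun w => p w + q w)%C; split.
  - exact: ccont_plus.
  - by rewrite p2 q2.
  - apply: filter_imp (filter_and _ _ p3 q3) => w [E1 E2].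
    have -> : (f w + g w - (f z + g z) = (f w - f z) + (g w - g z))%C by ring.
    by rewrite E1 E2; ring.
Qed.

Lemma cdiff_mult f g z l m :
  cdiff f z l -> cdiff g z m -> cdiff (fun w => f w * g w)%C z (l * g z + f z * m)%C.
Proof.
  move=> Hf Hg; have Hg' := cdiff_cont _ _ _ Hg.
  case: Hf => [p [p1 p2 p3]]; case: Hg => [q [q1 q2 q3]].
  exists (fun w => p w * g w + f z * q w)%C; split.
  - apply: ccont_plus; apply: ccont_mult => //; exact: ccont_const.
  - by rewrite p2 q2.
  - apply: filter_imp (filter_and _ _ p3 q3) => w [E1 E2].
    have -> : (f w * g w - f z * g z = (f w - f z) * g w + f z * (g w - g z))%C by ring.
    by rewrite E1 E2; ring.
Qed.

Lemma cdiff_comp f g z l m :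
  cdiff g z m -> cdiff f (g z) l -> cdiff (fun w => f (g w)) z (l * m)%C.
Proof.
  move=> Hg Hf; have Hg' := cdiff_cont _ _ _ Hg.
  case: Hf => [p [p1 p2 p3]]; case: Hg => [q [q1 q2 q3]].
  exists (fun w => p (g w) * q w)%C; split.
  - by apply: ccont_mult => //; apply: (ccont_comp g p).
  - by rewrite p2 q2.
  - have {p3}/locally_Cmod [d [dp Hd]] := p3.
    apply: filter_imp (filter_and _ _ (Hg' d dp) q3) => w [E1 E2].
    by rewrite (Hd _ E1) E2; ring.
Qed.

Lemma pdiff_comp f g t l m :
  pdiff g t m -> cdiff f (g t) l -> pdiff (fun s => f (g s)) t (l * m)%C.
Proof.
  move=> Hg Hf; have Hg' := pdiff_cont _ _ _ Hg.
  case: Hf => [p [p1 p2 p3]]; case: Hg => [q [q1 q2 q3]].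
  exists (fun w => p (g w) * q w)%C; split.
  - by apply: ccont_mult => //; apply: (ccont_comp g p).
  - by rewrite p2 q2.
  - have {p3}/locally_Cmod [d [dp Hd]] := p3.
    apply: filter_imp (filter_and _ _ (Hg' d dp) q3) => w [E1 E2].
    by rewrite (Hd _ E1) E2; ring.
Qed.

Lemma cdiff_Cinv (z : C) : z <> 0 -> cdiff Cinv z (- (/ z * / z))%C.
Proof.
  move=> Hz; exists (fun w => - (/ w * / z))%C; split=> //.
  - apply: ccont_opp; apply: ccont_mult; [exact: (ccont_Cinv z Hz) | exact: ccont_const].
  - apply: filter_imp (ccont_neq0 _ _ (ccont_id z) Hz) => w Hw.
    by field.
Qed.

Lemma pdiff_affine (u v : C) t : pdiff (fun s => u + RtoC s * v)%C t v.
Proof.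
  exists (fun _ => v); split=> //; first exact: ccont_const.
  by apply: filter_forall => s; rewrite RtoC_minus; ring.
Qed.

Lemma pdiff_plus f g t l m :
  pdiff f t l -> pdiff g t m -> pdiff (fun w => f w + g w)%C t (l + m)%C.
Proof.
  case=> [p [p1 p2 p3]] [q [q1 q2 q3]].
  exists (fun w => p w + q w)%C; split.
  - exact: ccont_plus.
  - by rewrite p2 q2.
  - apply: filter_imp (filter_and _ _ p3 q3) => w [E1 E2].
    have -> : (f w + g w - (f t + g t) = (f w - f t) + (g w - g t))%C by ring.
    by rewrite E1 E2; ring.
Qed.

Lemma pdiff_scal (c : C) g t m :
  pdiff g t m -> pdiff (fun w => c * g w)%C t (c * m)%C.
Proof.
  case=> [q [q1 q2 q3]]; exists (fun w => c * q w)%C; split.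
  - by apply: ccont_mult => //; apply: ccont_const.
  - by rewrite q2.
  - apply: filter_imp q3 => w E.
    have -> : (c * g w - c * g t = c * (g w - g t))%C by ring.
    by rewrite E; ring.
Qed.

Lemma pdiff_is_derive g t l : pdiff g t l -> is_derive (fun s => Re (g s)) t (Re l).
Proof.
  case=> phi [Hphi <- /locally_R [d [dp Hd]]].
  apply/is_derive_Reals => eps He.
  have /locally_R [d' [dp' Hd']] := Hphi eps He.
  have Hm : 0 < Rmin d d' by apply: Rmin_glb_lt.
  exists (mkposreal _ Hm) => h Hh /= Hlt.
  have Hs1 : Rabs (t + h - t) < d.
  { have -> : t + h - t = h by ring. exact: (Rlt_le_trans _ _ _ Hlt (Rmin_l _ _)). }
  have Hs2 : Rabs (t + h - t) < d'.
  { have -> : t + h - t = h by ring. exact: (Rlt_le_trans _ _ _ Hlt (Rmin_r _ _)). }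
  have E := Hd _ Hs1; have {Hd'} B := Hd' _ Hs2.
  have E' : Re (g (t + h)) - Re (g t) = Re (phi (t + h)) * h.
  { have := f_equal Re E; rewrite re_scal_r re_plus re_opp.
    by have -> : t + h - t = h by ring. }
  have -> : (Re (g (t + h)) - Re (g t)) / h - Re (phi t) = Re (phi (t + h) - phi t).
  { by rewrite E' re_plus re_opp; field. }
  exact: (Rle_lt_trans _ _ _ (re_le_Cmod _) B).
Qed.

(** * The complex exponential *)

Lemma Cexp_plus (z w : C) : Cexp (z + w)%C = (Cexp z * Cexp w)%C.
Proof.
  case: z => a b; case: w => c d.
  rewrite /Cexp /Cplus /Cmult /= exp_plus cos_plus sin_plus.
  by congr pair; ring.
Qed.

Lemma Cexp_0 : Cexp 0 = 1.
Proof. by rewrite /Cexp /= exp_0 cos_0 sin_0; congr pair; ring. Qed.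

Lemma Cmod_Cexp (z : C) : Cmod (Cexp z) = exp (Re z).
Proof.
  have Hp := exp_pos (Re z).
  rewrite /Cmod /Cexp /=.
  have := sin2_cos2 (Im z); rewrite /Rsqr => H.
  have -> : exp (Re z) * cos (Im z) * (exp (Re z) * cos (Im z) * 1) +
    exp (Re z) * sin (Im z) * (exp (Re z) * sin (Im z) * 1) =
    exp (Re z) * exp (Re z) * (sin (Im z) * sin (Im z) + cos (Im z) * cos (Im z)) by ring.
  rewrite H Rmult_1_r; apply: sqrt_square; lra.
Qed.

Lemma Cexp_neq0 (z : C) : Cexp z <> 0.
Proof. by apply/Cmod_gt_0; rewrite Cmod_Cexp; apply: exp_pos. Qed.

Lemma Cexp_RtoC (x : R) : Cexp (RtoC x) = RtoC (exp x).
Proof. by rewrite /Cexp /= cos_0 sin_0 /RtoC; congr pair; ring. Qed.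

(** Everything comes from $e^x\ge 1+x$, used at $x$ and at $-x$: the latter gives $e^x(1-x)\le 1$,
    while $(1+x+2x^2)(1-x)\ge 1$ for $|x|\le 1/2$. *)
Lemma exp_taylor1 (x : R) : Rabs x <= / 2 -> Rabs (exp x - 1 - x) <= 2 * x ^ 2.
Proof.
  move=> /Rabs_le_between Hx.
  have H1 := exp_ineq1_le x; have H2 := exp_ineq1_le (- x).
  have H3 : exp x * exp (- x) = 1 by rewrite -exp_plus Rplus_opp_r exp_0.
  have H4 := exp_pos x.
  apply/Rabs_le_between; split; first nra.
  have H5 : exp x * (1 - x) <= 1 by nra.
  have H6 : 1 <= (1 + x + 2 * x ^ 2) * (1 - x) by nra.
  nra.
Qed.

Lemma abs_increment_le (f df : R -> R) (y k : R) :
  (forall x, is_derive f x (df x)) ->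
  (forall x, Rabs x <= Rabs y -> Rabs (df x) <= k) ->
  Rabs (f y - f 0) <= k * Rabs y.
Proof.
  move=> Hd Hk.
  have [c [Hc ->]] : exists c, Rmin 0 y <= c <= Rmax 0 y /\ f y - f 0 = df c * (y - 0).
  { apply: MVT_gen => x _; first exact: Hd.
    apply: derivable_continuous_pt; exists (df x); apply/is_derive_Reals; exact: Hd. }
  rewrite Rabs_mult Rminus_0_r; apply: Rmult_le_compat_r; first exact: Rabs_pos.
  apply: Hk; move: Hc; rewrite /Rmin /Rmax.
  by case: Rle_dec => ?; split_Rabs; lra.
Qed.

Lemma abs_sin_le (y : R) : Rabs (sin y) <= Rabs y.
Proof.
  have := abs_increment_le sin cos y 1; rewrite sin_0 Rminus_0_r Rmult_1_l; apply.
  - by move=> x; apply: is_derive_sin.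
  - by move=> x _; apply/Rabs_le_between; have := COS_bound x; lra.
Qed.

Lemma cos_taylor1 (y : R) : Rabs (cos y - 1) <= y ^ 2.
Proof.
  have H := cos_2a_sin (y / 2).
  have E : 2 * (y / 2) = y by field.
  rewrite E in H.
  have H1 := abs_sin_le (y / 2).
  have H2 : sin (y / 2) ^ 2 <= (y / 2) ^ 2.
  { rewrite -(pow2_abs (sin _)) -(pow2_abs (y / 2)); apply: pow_incr.
    by split=> //; apply: Rabs_pos. }
  apply/Rabs_le_between; nra.
Qed.

Lemma sin_taylor1 (y : R) : Rabs y <= 1 -> Rabs (sin y - y) <= y ^ 2.
Proof.
  move=> Hy.
  have := abs_increment_le (fun x => sin x - x) (fun x => cos x - 1) y (y ^ 2).
  rewrite sin_0 !Rminus_0_r => H.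
  have H' : Rabs (sin y - y) <= y ^ 2 * Rabs y.
  { apply: H => x; first by auto_derive => //; ring.
    move=> Hx; apply: (Rle_trans _ _ _ (cos_taylor1 x)).
    by rewrite -(pow2_abs x) -(pow2_abs y); apply: pow_incr; split=> //; apply: Rabs_pos. }
  have := pow2_ge_0 y; have := Rabs_pos y; nra.
Qed.

(** For $h=x+iy$ the error has real part $(e^x-1-x)+e^x(\cos y-1)$ and imaginary part $(e^x-1)\sin
    y+(\sin y-y)$, where each term is of second order. The constant 10 is generous. *)
Lemma Cexp_taylor1 (h : C) :
  Cmod h <= / 2 -> Cmod (Cexp h - 1 - h) <= 10 * Cmod h ^ 2.
Proof.
  case: h => x y Hh.
  have Hx : Rabs x <= Cmod (x, y) by apply: (re_le_Cmod (x, y)).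
  have Hy : Rabs y <= Cmod (x, y) by apply: (im_le_Cmod (x, y)).
  have Ex := exp_taylor1 x (Rle_trans _ _ _ Hx Hh).
  have Cy := cos_taylor1 y.
  have Sy : Rabs (sin y - y) <= y ^ 2 by apply: sin_taylor1; lra.
  have Sy' := abs_sin_le y.
  have Px := Rabs_pos x; have Py := Rabs_pos y.
  have E2 : Rabs (exp x - 1) <= 2 * Rabs x.
  { have -> : exp x - 1 = (exp x - 1 - x) + x by ring.
    apply: (Rle_trans _ _ _ (Rabs_triang _ _)).
    move: Ex; rewrite -(pow2_abs x) => Ex; nra. }
  have Epos := exp_pos x.
  have E3 : exp x <= 2 by move: E2 => /Rabs_le_between; lra.
  apply: (Rle_trans _ _ _ (Cmod_le_abs _)).
  have -> : Re (Cexp (x, y) - 1 - (x, y)) = (exp x - 1 - x) + exp x * (cos y - 1)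
    by rewrite /=; ring.
  have -> : Im (Cexp (x, y) - 1 - (x, y)) = (exp x - 1) * sin y + (sin y - y)
    by rewrite /=; ring.
  have T1 := Rabs_triang (exp x - 1 - x) (exp x * (cos y - 1)).
  have T2 := Rabs_triang ((exp x - 1) * sin y) (sin y - y).
  rewrite !Rabs_mult (Rabs_pos_eq (exp x)) in T1 T2; last lra.
  have P1 := Rabs_pos (cos y - 1); have P2 := Rabs_pos (sin y); have P3 := Rabs_pos (exp x - 1).
  have Q1 : exp x * Rabs (cos y - 1) <= 2 * y ^ 2 by nra.
  have Q2 : Rabs (exp x - 1) * Rabs (sin y) <= 2 * Rabs x * Rabs y by nra.
  move: (Cmod (x, y)) Hh Hx Hy => m Hh Hx Hy.
  move: Ex Sy Q1; rewrite -(pow2_abs x) -(pow2_abs y) => *; nra.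
Qed.

(** The slope is the difference quotient, completed by $e^z$ at $z$. Its continuity there reduces to
    the second-order bound through $e^w=e^ze^{w-z}$. *)
Lemma cdiff_Cexp (z : C) : cdiff Cexp z (Cexp z).
Proof.
  exists (fun w => if Ceq_dec w z then Cexp z else ((Cexp w - Cexp z) / (w - z))%C).
  split.
  - move=> eps He; apply/locally_Cmod.
    have Hz := exp_pos (Re z).
    exists (Rmin (/ 2) (eps / (11 * exp (Re z)))); split.
    { apply: Rmin_glb_lt; first lra. apply: Rdiv_lt_0_compat; lra. }
    move=> w Hw.
    case: (Ceq_dec z z) => [Ez|//] /=; clear Ez.
    case: (Ceq_dec w z) => [E|Hn].
    { have -> : (Cexp z - Cexp z)%C = 0 by ring. by rewrite Cmod_0. }
    have Hh0 : (w - z)%C <> 0 by apply: Cminus_eq_contra.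
    have Hm : 0 < Cmod (w - z) by apply/Cmod_gt_0.
    have H1 : Cmod (w - z) <= / 2 by left; apply: (Rlt_le_trans _ _ _ Hw); apply: Rmin_l.
    have H2 : Cmod (w - z) * (11 * exp (Re z)) < eps.
    { apply/Rlt_div_r; first lra. by apply: (Rlt_le_trans _ _ _ Hw); apply: Rmin_r. }
    have -> : ((Cexp w - Cexp z) / (w - z) - Cexp z)%C =
      (Cexp z * ((Cexp (w - z) - 1 - (w - z)) / (w - z)))%C.
    { have -> : Cexp w = (Cexp z * Cexp (w - z))%C.
      { rewrite -Cexp_plus; congr Cexp; ring. }
      by field. }
    rewrite Cmod_mult Cmod_Cexp Cmod_div //.
    have H3 : Cmod (Cexp (w - z) - 1 - (w - z)) / Cmod (w - z) <= 10 * Cmod (w - z).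
    { apply/Rle_div_l => //. have := Cexp_taylor1 _ H1; nra. }
    nra.
  - by case: (Ceq_dec z z).
  - apply: filter_forall => w; case: (Ceq_dec w z) => [E|Hn] /=; first by rewrite E; ring.
    by field; apply: Cminus_eq_contra.
Qed.

Lemma ccont_Cexp (z : C) : ccont (T := C_UniformSpace) Cexp z.
Proof. exact: cdiff_cont (cdiff_Cexp z). Qed.

(** * The complex hyperbolic sine: lower bound and growth *)

Definition Csinh (z : C) : C := ((Cexp z - Cexp (- z)) * RtoC (/ 2))%C.

Lemma Csinh_RtoC (x : R) : Csinh (RtoC x) = RtoC (sinh x).
Proof.
  by rewrite /Csinh -RtoC_opp !Cexp_RtoC -RtoC_minus -RtoC_mult /sinh.
Qed.

(** By the mean value theorem $\sinh x=x\cosh c$, and $\cosh c\ge 1$. *)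
Lemma abs_le_sinh (x : R) : Rabs x <= Rabs (sinh x).
Proof.
  wlog Hx : x / 0 <= x.
  { move=> H; case: (Rle_dec 0 x) => Hx; first exact: H.
    have := H (- x); rewrite /sinh Ropp_involutive Rabs_Ropp.
    have -> : (exp (- x) - exp x) / 2 = - ((exp x - exp (- x)) / 2) by field.
    rewrite Rabs_Ropp; apply; lra. }
  have [c [Hc E]] : exists c, Rmin 0 x <= c <= Rmax 0 x /\ sinh x - sinh 0 = cosh c * (x - 0).
  { apply: MVT_gen => y _; first by apply/is_derive_Reals; apply: derivable_pt_lim_sinh.
    apply: derivable_continuous_pt; exists (cosh y); exact: derivable_pt_lim_sinh. }
  rewrite sinh_0 !Rminus_0_r in E.
  have Hcosh : 1 <= cosh c.
  { rewrite /cosh; have := exp_ineq1_le c; have := exp_ineq1_le (- c).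
    have H3 : exp c * exp (- c) = 1 by rewrite -exp_plus Rplus_opp_r exp_0.
    have := exp_pos c; have := exp_pos (- c); nra. }
  rewrite E !Rabs_pos_eq //; nra.
Qed.

(** The triangle inequality gives $|\sinh z|\ge|\sinh(\Re z)|$. The control of all denominators
    rests on this bound: it confines the zeros of [Csinh] to the imaginary axis. *)
Lemma abs_Re_le_Csinh (z : C) : Rabs (Re z) <= Cmod (Csinh z).
Proof.
  apply: (Rle_trans _ _ _ (abs_le_sinh _)).
  rewrite /Csinh Cmod_mult Cmod_R (Rabs_pos_eq (/ 2)); last lra.
  have H1 := Cmod_le_plus (Cexp z) (Cexp (- z)).
  have H2 := Cmod_le_plus (Cexp (- z)) (Cexp z).
  rewrite (Cmod_minus_sym (Cexp (- z))) in H2.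
  rewrite !Cmod_Cexp re_opp in H1 H2.
  rewrite /sinh; apply/Rabs_le_between; lra.
Qed.

Lemma Csinh_neq0 (z : C) : Re z <> 0 -> Csinh z <> 0.
Proof.
  move=> Hz; apply/Cmod_gt_0.
  apply: (Rlt_le_trans _ (Rabs (Re z))); first exact: Rabs_pos_lt.
  exact: abs_Re_le_Csinh.
Qed.

Lemma exp_le_compat (x y : R) : x <= y -> exp x <= exp y.
Proof. by case=> [H| ->]; [left; apply: exp_increasing | right]. Qed.

(** The factor [Cmod z] in front of the exponential is what compensates the zero of the denominator
    at the origin in a quotient of two hyperbolic sines. *)
Lemma Csinh_le (z : C) : Cmod (Csinh z) <= 2 * Cmod z * exp (Cmod z).
Proof.
  case: z => x y.
  have Hx : Rabs x <= Cmod (x, y) by apply: (re_le_Cmod (x, y)).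
  have Hy : Rabs y <= Cmod (x, y) by apply: (im_le_Cmod (x, y)).
  apply: (Rle_trans _ _ _ (Cmod_le_abs _)).
  have -> : Re (Csinh (x, y)) = sinh x * cos y.
  { by rewrite /Csinh /sinh /= cos_neg; field. }
  have -> : Im (Csinh (x, y)) = cosh x * sin y.
  { by rewrite /Csinh /cosh /= sin_neg; field. }
  have Hc (t : R) : Rabs t <= Cmod (x, y) -> Rabs (cosh t) <= exp (Cmod (x, y)).
  { move=> Ht; rewrite /cosh.
    have H1 : exp t <= exp (Cmod (x, y)) by apply: exp_le_compat; split_Rabs; lra.
    have H2 : exp (- t) <= exp (Cmod (x, y)) by apply: exp_le_compat; split_Rabs; lra.
    have := exp_pos t; have := exp_pos (- t) => ? ?.
    by rewrite Rabs_pos_eq; lra. }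
  have Hs : Rabs (sinh x) <= exp (Cmod (x, y)) * Rabs x.
  { have := abs_increment_le sinh cosh x (exp (Cmod (x, y))).
    rewrite sinh_0 Rminus_0_r; apply.
    - by move=> t; apply/is_derive_Reals; apply: derivable_pt_lim_sinh.
    - by move=> t Ht; apply: Hc; lra. }
  have Hcx := Hc x Hx.
  have Hsy := abs_sin_le y.
  have Hcy : Rabs (cos y) <= 1 by apply/Rabs_le_between; have := COS_bound y; lra.
  rewrite (Rabs_mult (sinh x)) (Rabs_mult (cosh x)).
  have := Rabs_pos (sinh x); have := Rabs_pos (cos y); have := Rabs_pos (sin y).
  have := Rabs_pos (cosh x); have := exp_pos (Cmod (x, y)).
  have := Rabs_pos x; have := Rabs_pos y.
  move: (Cmod (x, y)) (exp _) Hx Hy {Hc} Hs Hcx => m E Hx Hy Hs Hcx P1 P2 P3 P4 P5 P6 P7.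
  have Q1 : Rabs (sinh x) * Rabs (cos y) <= E * m.
  { apply: (Rle_trans _ (E * Rabs x * 1)); last by nra.
    by apply: Rmult_le_compat. }
  have Q2 : Rabs (cosh x) * Rabs (sin y) <= E * m by apply: Rmult_le_compat => //; lra.
  have -> : 2 * m * E = E * m + E * m by ring.
  by apply: Rplus_le_compat.
Qed.

(** * Holomorphic functions *)

(** Continuity of the derivative is included because Cauchy's theorem is proved by differentiating
    under the integral sign. *)
Definition holo (U : C -> Prop) (f : C -> C) : Prop :=
  exists f' : C -> C, forall z, U z ->
    cdiff f z (f' z) /\ ccont (T := C_UniformSpace) f' z.

Section Holo.
Context (U : C -> Prop).

Lemma holo_const c : holo U (fun _ => c).
Proof. by exists (fun _ => RtoC 0) => z _; split; [apply: cdiff_const | apply: ccont_const]. Qed.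

Lemma holo_id : holo U (fun w => w).
Proof. by exists (fun _ => RtoC 1) => z _; split; [apply: cdiff_id | apply: ccont_const]. Qed.

Lemma holo_plus f g : holo U f -> holo U g -> holo U (fun w => f w + g w)%C.
Proof.
  case=> f' Hf [g' Hg]; exists (fun w => f' w + g' w)%C => z Uz.
  have [f1 f2] := Hf z Uz; have [g1 g2] := Hg z Uz.
  by split; [apply: cdiff_plus | apply: ccont_plus].
Qed.

Lemma holo_mult f g : holo U f -> holo U g -> holo U (fun w => f w * g w)%C.
Proof.
  case=> f' Hf [g' Hg]; exists (fun w => f' w * g w + f w * g' w)%C => z Uz.
  have [f1 f2] := Hf z Uz; have [g1 g2] := Hg z Uz.
  split; first exact: cdiff_mult.
  by apply: ccont_plus; apply: ccont_mult => //; apply: cdiff_cont; eassumption.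
Qed.

Lemma holo_opp f : holo U f -> holo U (fun w => - f w)%C.
Proof.
  move=> Hf; have [f' Hf'] := holo_mult _ _ (holo_const (- (1))%C) Hf.
  exists f' => z Uz; have [[phi [P1 P2 P3]] Hc] := Hf' z Uz; split=> //.
  exists phi; split=> //; apply: filter_imp P3 => w <-; ring.
Qed.

Lemma holo_Cexp f : holo U f -> holo U (fun w => Cexp (f w)).
Proof.
  case=> f' Hf; exists (fun w => Cexp (f w) * f' w)%C => z Uz.
  have [f1 f2] := Hf z Uz.
  split; first by apply: (cdiff_comp Cexp f) => //; apply: cdiff_Cexp.
  apply: ccont_mult => //; apply: (ccont_comp f Cexp); last exact: ccont_Cexp.
  exact: cdiff_cont f1.
Qed.

Lemma holo_Cinv (f : C -> C) : (forall z, U z -> f z <> 0) -> holo U f -> holo U (fun w => / f w)%C.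
Proof.
  move=> H0 [f' Hf]; exists (fun w => - (/ f w * / f w) * f' w)%C => z Uz.
  have [f1 f2] := Hf z Uz.
  split; first by apply: (cdiff_comp Cinv f) => //; apply: cdiff_Cinv; apply: H0.
  have Hi : ccont (T := C_UniformSpace) (fun w => / f w)%C z.
  { apply: (ccont_comp f Cinv); first exact: cdiff_cont f1.
    by apply: ccont_Cinv; apply: H0. }
  by apply: ccont_mult => //; apply: ccont_opp; apply: ccont_mult.
Qed.

Lemma holo_Csinh f : holo U f -> holo U (fun w => Csinh (f w)).
Proof.
  move=> Hf; apply: holo_mult; last exact: holo_const.
  apply: holo_plus; first exact: holo_Cexp.
  by apply: holo_opp; apply: holo_Cexp; apply: holo_opp.
Qed.

End Holo.

(** * Integrals of complex-valued functions *)

Definition is_CInt (f : R -> C) (a b : R) (l : C) : Prop :=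
  is_RInt (V := C_R_NormedModule) f a b l.

Lemma norm_Cmod (z : C) : norm (z : C_R_NormedModule) = Cmod z.
Proof.
  rewrite /Cmod -(pow2_abs (fst z)) -(pow2_abs (snd z)).
  by case: z.
Qed.

Lemma is_CInt_pair f a b l :
  is_CInt f a b l <->
  is_RInt (fun t => Re (f t)) a b (Re l) /\ is_RInt (fun t => Im (f t)) a b (Im l).
Proof.
  split.
  - move=> H; split.
    + exact: (is_RInt_fct_extend_fst (U := R_NormedModule) (V := R_NormedModule) f).
    + exact: (is_RInt_fct_extend_snd (U := R_NormedModule) (V := R_NormedModule) f).
  - case=> H1 H2; case: l H1 H2 => l1 l2.
    exact: (is_RInt_fct_extend_pair (U := R_NormedModule) (V := R_NormedModule) f).
Qed.

Lemma is_CInt_scal (c : C) f a b l :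
  is_CInt f a b l -> is_CInt (fun t => c * f t)%C a b (c * l)%C.
Proof.
  move=> /is_CInt_pair [H1 H2]; apply/is_CInt_pair; split.
  - exact: (is_RInt_minus _ _ _ _ _ _ (is_RInt_scal _ _ _ (Re c) _ H1)
      (is_RInt_scal _ _ _ (Im c) _ H2)).
  - exact: (is_RInt_plus _ _ _ _ _ _ (is_RInt_scal _ _ _ (Re c) _ H2)
      (is_RInt_scal _ _ _ (Im c) _ H1)).
Qed.

Lemma is_CInt_plus f g a b l m :
  is_CInt f a b l -> is_CInt g a b m -> is_CInt (fun t => f t + g t)%C a b (l + m)%C.
Proof. exact: is_RInt_plus. Qed.

Lemma is_CInt_ext f g a b l :
  (forall t, f t = g t) -> is_CInt f a b l -> is_CInt g a b l.
Proof. by move=> H; apply: is_RInt_ext => t _. Qed.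

Lemma is_CInt_unique f a b l m : is_CInt f a b l -> is_CInt f a b m -> l = m.
Proof.
  move=> Hl Hm.
  by rewrite -(is_RInt_unique (V := C_R_CompleteNormedModule) _ _ _ _ Hl)
    -(is_RInt_unique (V := C_R_CompleteNormedModule) _ _ _ _ Hm).
Qed.

Lemma is_CInt_le f a b l M :
  a <= b -> (forall t, Cmod (f t) <= M) -> is_CInt f a b l -> Cmod l <= (b - a) * M.
Proof.
  move=> Hab HM Hl; rewrite -norm_Cmod.
  apply: (norm_RInt_le_const f a b _ M Hab) Hl => t _.
  by rewrite norm_Cmod.
Qed.

Lemma ccont_ex_CInt f a b : (forall t, ccont f t) -> exists l, is_CInt f a b l.
Proof.
  move=> Hf; apply: (ex_RInt_continuous (V := C_R_CompleteNormedModule)) => t _.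
  by apply/ccont_continuous.
Qed.

(** * Cauchy's formula on a circle *)

Definition cis (t : R) : C := Cexp (RtoC t * Ci).

Lemma cis_2PI : cis (2 * PI) = cis 0.
Proof.
  rewrite /cis /Cexp /=.
  have -> : 2 * PI * 0 - 0 * 1 = 0 * 0 - 0 * 1 by ring.
  have -> : 2 * PI * 1 + 0 * 0 = 2 * PI by ring.
  have -> : 0 * 1 + 0 * 0 = 0 by ring.
  by rewrite cos_2PI sin_2PI cos_0 sin_0.
Qed.

Lemma Cmod_cis t : Cmod (cis t) = 1.
Proof.
  rewrite /cis Cmod_Cexp /=; have -> : t * 0 - 0 * 1 = 0 by ring.
  exact: exp_0.
Qed.

Lemma cis_neq0 t : cis t <> 0.
Proof. exact: Cexp_neq0. Qed.

Lemma pdiff_ext f g t l m : (forall s, f s = g s) -> l = m -> pdiff f t l -> pdiff g t m.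
Proof.
  move=> H -> [phi [P1 P2 P3]]; exists phi; split=> //.
  by apply: filter_imp P3 => s; rewrite !H.
Qed.

Lemma pdiff_cis t : pdiff cis t (cis t * Ci)%C.
Proof.
  apply: (pdiff_comp Cexp (fun s => RtoC s * Ci)%C); last exact: cdiff_Cexp.
  by apply: pdiff_ext (pdiff_affine 0 Ci t) => // s; ring.
Qed.

Lemma is_RInt_closed_path (G g : R -> C) :
  (forall t, pdiff G t (g t)) -> (forall t, ccont g t) ->
  G (2 * PI) = G 0 -> is_RInt (fun t => Re (g t)) 0 (2 * PI) 0.
Proof.
  move=> HG Hg E.
  have : is_RInt (fun t => Re (g t)) 0 (2 * PI) (minus (Re (G (2 * PI))) (Re (G 0))).
  { apply: (is_RInt_derive (fun t => Re (G t))) => t _.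
    - exact: pdiff_is_derive.
    - exact: ccont_continuous_Re. }
  by rewrite E /minus plus_opp_r.
Qed.

Section Cauchy.
Context (f f' : C -> C) (w0 h : C) (rho : R).
Context (rho_gt0 : 0 < rho) (h_lt : Cmod h < rho).
Context (f_diff : forall z, Cmod (z - w0) < 4 * rho ->
  cdiff f z (f' z) /\ ccont (T := C_UniformSpace) f' z).

(** [pt x t] runs along the segment from $w_0+h$, at $x=0$, to the point $w_0+\rho e^{it}$ of the
    circle, at $x=1$: a homotopy between the circle and the point where [f] is to be evaluated. *)
Let ray (t : R) : C := (RtoC rho * cis t - h)%C.
Let pt (x t : R) : C := (w0 + h + RtoC x * ray t)%C.

Lemma ray_neq0 t : ray t <> 0.
Proof.
  move=> E.
  have : Cmod (RtoC rho * cis t) = Cmod h.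
  { congr Cmod; have := E; rewrite /ray => E'.
    have -> : (RtoC rho * cis t = (RtoC rho * cis t - h) + h)%C by ring.
    by rewrite E'; ring. }
  rewrite Cmod_mult Cmod_cis Cmod_R Rabs_pos_eq; lra.
Qed.

Lemma ray_ge t : rho - Cmod h <= Cmod (ray t).
Proof.
  have := Cmod_le_plus (RtoC rho * cis t) h.
  rewrite Cmod_mult Cmod_cis Cmod_R Rabs_pos_eq -/(ray t); lra.
Qed.

Lemma pdiff_ray t : pdiff ray t (RtoC rho * (cis t * Ci))%C.
Proof.
  apply: (pdiff_ext (fun s => - h + RtoC rho * cis s)%C _ _ (0 + RtoC rho * (cis t * Ci))%C).
  - by move=> s; rewrite /ray; ring.
  - by ring.
  - apply: pdiff_plus; last by apply: pdiff_scal; exact: pdiff_cis.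
    by apply: pdiff_ext (pdiff_affine (- h) 0 t) => // s; ring.
Qed.

(** $|h|+|x|\,|\rho e^{it}-h|<\rho+\frac54\cdot 2\rho<4\rho$. The parameter overshoots $[0,1]$
    because the integral is also differentiated at the endpoints; this accounts for the disc of
    radius $4\rho$. *)
Lemma pt_in x t : -1/4 < x < 5/4 -> Cmod (pt x t - w0) < 4 * rho.
Proof.
  move=> Hx.
  have -> : (pt x t - w0 = h + RtoC x * ray t)%C by rewrite /pt; ring.
  apply: (Rle_lt_trans _ _ _ (Cmod_triangle _ _)).
  rewrite Cmod_mult Cmod_R.
  have H1 : Cmod (ray t) <= 2 * rho.
  { apply: (Rle_trans _ _ _ (Cmod_sub_le _ _)).
    rewrite Cmod_mult Cmod_cis Cmod_R Rabs_pos_eq; lra. }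
  have H2 : Rabs x <= 5/4 by apply/Rabs_le_between; lra.
  have := Cmod_ge_0 (ray t); have := Rabs_pos x; nra.
Qed.

Lemma ccont_cis t : ccont cis t.
Proof. exact: pdiff_cont (pdiff_cis t). Qed.

Lemma ccont_pt2 x t : ccont (T := prod_UniformSpace R_UniformSpace R_UniformSpace)
  (fun p => pt p.1 p.2) (x, t).
Proof.
  apply: ccont_plus; first exact: ccont_const.
  apply: ccont_mult.
  - apply: ccont_RtoC; exact: continuous_fst.
  - apply: (ccont_comp_R ray snd); first exact: continuous_snd.
    exact: pdiff_cont (pdiff_ray _).
Qed.

Lemma ccont_pt x t : ccont (pt x) t.
Proof.
  apply: ccont_plus; first exact: ccont_const.
  apply: ccont_mult; first exact: ccont_const.
  exact: pdiff_cont (pdiff_ray _).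
Qed.

(** Cauchy's kernel $d\zeta/(\zeta-w_0-h)$ on the circle, divided by $i\,dt$. *)
Let ker (t : R) : C := (RtoC rho * cis t / ray t)%C.

Lemma ccont_ker t : ccont ker t.
Proof.
  apply: ccont_mult.
  - apply: ccont_mult; [exact: ccont_const | exact: ccont_cis].
  - apply: (ccont_comp ray Cinv); first exact: pdiff_cont (pdiff_ray _).
    apply: ccont_Cinv; exact: ray_neq0.
Qed.

(** For $x\ne 0$ the integrand is the $t$-derivative of $f(\mathrm{pt}\,x\,t)/(ix)$, which is
    periodic. At $x=0$ the point no longer moves and a constant multiple of [cis] is a primitive. *)
Lemma integral_deriv_closed x : -1/4 < x < 5/4 ->
  is_RInt (fun t => Re (f' (pt x t) * (RtoC rho * cis t))) 0 (2 * PI) 0.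
Proof.
  move=> Hx.
  have Hc t : ccont (fun t => f' (pt x t) * (RtoC rho * cis t))%C t.
  { apply: ccont_mult.
    - apply: (ccont_comp (pt x) f'); first exact: ccont_pt.
      by apply (f_diff (pt x t)); apply: pt_in.
    - by apply: ccont_mult; [exact: ccont_const | exact: ccont_cis]. }
  case: (Req_dec x 0) => [E|Hn].
  - apply: (is_RInt_closed_path (fun t => - Ci * f' (w0 + h) * RtoC rho * cis t)%C) => //.
    + move=> t; apply: pdiff_ext (pdiff_scal (- Ci * f' (w0 + h) * RtoC rho)%C _ _ _ (pdiff_cis t)) => //.
      have -> : pt x t = (w0 + h)%C by rewrite /pt E Cmult_0_l Cplus_0_r.
      have Ci2 : (Ci * Ci = - (1))%C by rewrite /Ci /Cmult /Copp /RtoC /=; congr pair; ring.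
      have -> : (- Ci * f' (w0 + h) * rho * (cis t * Ci) = - (Ci * Ci) * f' (w0 + h) * (rho * cis t))%C by ring.
      by rewrite Ci2; ring.
    + by rewrite cis_2PI.
  - apply: (is_RInt_closed_path (fun t => / (RtoC x * Ci) * f (pt x t))%C) => //.
    + move=> t.
      have Hp : pdiff (pt x) t (RtoC x * (RtoC rho * (cis t * Ci)))%C.
      { apply: (pdiff_ext (fun s => (w0 + h) + RtoC x * ray s)%C _ _
          (0 + RtoC x * (RtoC rho * (cis t * Ci)))%C) => //; first by ring.
        apply: pdiff_plus; last by apply: pdiff_scal; exact: pdiff_ray.
        by apply: pdiff_ext (pdiff_affine (w0 + h) 0 t) => // s; ring. }
      have [Hf _] := f_diff (pt x t) (pt_in x t Hx).
      apply: pdiff_ext (pdiff_scal (/ (RtoC x * Ci))%C _ _ _ (pdiff_comp f _ _ _ _ Hp Hf)) => //.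
      have Hx0 : RtoC x <> 0 by move=> /RtoC_inj.
      by field; split=> //; exact: Ci_nz.
    + by rewrite /pt /ray cis_2PI.
Qed.

(** The integral is constant in $x$, its derivative being the vanishing integral above. At $x=1$ it
    is Cauchy's integral over the circle, at $x=0$ it is $f(w_0+h)$ against the kernel. Real parts
    are taken because the differentiation under the integral is carried out on real functions. *)
Lemma cauchy_homotopy :
  RInt (fun t => Re (f (pt 1 t) * ker t)) 0 (2 * PI) =
  RInt (fun t => Re (f (pt 0 t) * ker t)) 0 (2 * PI).
Proof.
  pose g x t := Re (f (pt x t) * ker t)%C.
  have Hloc x : 0 <= x <= 1 -> locally x (fun y : R => -1/4 < y < 5/4).
  { move=> Hx; apply/locally_R; exists (/4); split; first lra.
    by move=> y /Rabs_lt_between; lra. }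
  have Hder x t : -1/4 < x < 5/4 ->
    is_derive (fun y => g y t) x (Re (f' (pt x t) * (RtoC rho * cis t))).
  { move=> Hx; apply: pdiff_is_derive.
    have [Hf _] := f_diff (pt x t) (pt_in x t Hx).
    (* Differentiating in $x$ produces the factor [ray t], which cancels the denominator of
       [ker t]. *)
    have := pdiff_scal (ker t) _ _ _ (pdiff_comp f (fun y => pt y t) x _ _ (pdiff_affine (w0 + h) (ray t) x) Hf).
    apply: pdiff_ext; first by move=> y; ring.
    rewrite /ker; field; exact: ray_neq0. }
  symmetry.
  apply: (eq_is_derive (fun x => RInt (g x) 0 (2 * PI))); last lra.
  move=> x Hx.
  have Hx' : -1/4 < x < 5/4 by lra.
  have E : RInt (fun t => Derive (fun y => g y t) x) 0 (2 * PI) = 0.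
  { apply: etrans (is_RInt_unique _ _ _ _ (integral_deriv_closed x Hx')).
    by apply: RInt_ext => t _; apply: is_derive_unique; apply: Hder. }
  suff : is_derive (fun x => RInt (g x) 0 (2 * PI)) x
    (RInt (fun t => Derive (fun y => g y t) x) 0 (2 * PI)) by rewrite E.
  apply: is_derive_RInt_param.
  - apply: filter_imp (Hloc x Hx) => y Hy t _.
    by eexists; apply: Hder.
  - move=> t _.
    apply: (continuity_2d_pt_ext_loc (fun u v => Re (f' (pt u v) * (RtoC rho * cis v)))).
    + apply/locally_2d_locally.
      apply: (filter_imp (fun p : R * R => -1/4 < p.1 < 5/4)).
      * by move=> p Hp; symmetry; apply: is_derive_unique; apply: Hder.
      * exact: (@continuous_fst R_UniformSpace R_UniformSpace x t _ (Hloc x Hx)).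
    + apply/continuity_2d_pt_filterlim.
      apply: (ccont_continuous_Re (T := prod_UniformSpace R_UniformSpace R_UniformSpace)
        (fun p => f' (pt p.1 p.2) * (RtoC rho * cis p.2))%C (x, t)).
      apply: ccont_mult.
      * apply: (ccont_comp (fun p => pt p.1 p.2) f'); first exact: ccont_pt2.
        by apply (f_diff (pt x t)); apply: pt_in.
      * apply: ccont_mult; first exact: ccont_const.
        apply: (ccont_comp_R cis snd); first exact: continuous_snd.
        exact: ccont_cis.
  - apply: filter_imp (Hloc x Hx) => y Hy.
    apply: (ex_RInt_continuous (V := R_CompleteNormedModule)) => t _.
    apply: ccont_continuous_Re; apply: ccont_mult; last exact: ccont_ker.
    apply: (ccont_comp (pt y) f); first exact: ccont_pt.
    have [Hf _] := f_diff (pt y t) (pt_in y t Hy).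
    exact: cdiff_cont Hf.
Qed.

End Cauchy.

(** * Taylor expansion *)

Fixpoint psum (a : nat -> C) (h : C) (N : nat) : C :=
  match N with
  | O => 0
  | S n => (psum a h n + a n * h ^ n)%C
  end.

Lemma le_geom_0 (x K q : R) :
  0 <= x -> 0 <= q < 1 -> (forall N : nat, x <= K * q ^ N.+1) -> x = 0.
Proof.
  move=> Hx Hq H; apply: Rle_antisym => //.
  apply: le_epsilon => eps He; rewrite Rplus_0_l.
  have HK : 0 < Rabs K + 1 by have := Rabs_pos K; lra.
  have Habs : Rabs q < 1 by rewrite Rabs_pos_eq; lra.
  have [N HN] := pow_lt_1_zero q Habs (eps / (Rabs K + 1)) (Rdiv_lt_0_compat _ _ He HK).
  have {HN} := HN N.+1 ltac:(lia).
  rewrite Rabs_pos_eq; last by apply: pow_le; lra.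
  move=> /(Rlt_div_r _ _ _ HK) Hlt.
  apply: (Rle_trans _ _ _ (H N)).
  have Hp : 0 <= q ^ N.+1 by apply: pow_le; lra.
  have := Rle_abs K; nra.
Qed.

(** Carries results on real parts over to imaginary parts, by applying them to $-if$. *)
Lemma Im_Re (z : C) : Im z = Re (- Ci * z)%C.
Proof. by case: z => x y; rewrite /Re /Im /=; ring. Qed.

Lemma is_CInt_closed_path (G g : R -> C) :
  (forall t, pdiff G t (g t)) -> (forall t, ccont g t) ->
  G (2 * PI) = G 0 -> is_CInt g 0 (2 * PI) 0.
Proof.
  move=> HG Hg E; apply/is_CInt_pair; split; first exact: (is_RInt_closed_path G).
  apply: (is_RInt_ext (fun t => Re (- Ci * g t))).
  { by move=> t _; rewrite -Im_Re. }
  apply: (is_RInt_closed_path (fun t => - Ci * G t)%C).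
  - by move=> t; apply: pdiff_scal.
  - by move=> t; apply: ccont_mult => //; exact: ccont_const.
  - by rewrite E.
Qed.

Lemma cdiff_pow (n : nat) (z : C) : cdiff (fun w => w ^ n.+1)%C z (RtoC (INR n.+1) * z ^ n)%C.
Proof.
  elim: n => [|n IH].
  - have := cdiff_mult _ _ _ _ _ (cdiff_id z) (cdiff_const 1 z).
    have -> : (1 * 1 + z * 0 = RtoC (INR 1) * z ^ 0)%C by rewrite /=; ring.
    by [].
  - have := cdiff_mult _ _ _ _ _ (cdiff_id z) IH.
    have -> : (1 * z ^ n.+1 + z * (RtoC (INR n.+1) * z ^ n) = RtoC (INR n.+2) * z ^ n.+1)%C.
    { by rewrite (S_INR n.+1) RtoC_plus Cpow_S; ring. }
    by [].
Qed.

Lemma ccont_pow {T : UniformSpace} (f : T -> C) x (n : nat) :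
  ccont f x -> ccont (fun y => f y ^ n)%C x.
Proof.
  move=> Hf; elim: n => [|n IH]; first exact: ccont_const.
  by apply: (ccont_mult f (fun y => f y ^ n)%C).
Qed.

(** * Geometric expansion of Cauchy's kernel *)

Section Kernel.
Context (rho : R).
Context (rho_gt0 : 0 < rho).

(** The reciprocal of $\zeta=\rho e^{it}$; the kernel is the geometric series of ratio $h/\zeta$. *)
Let e (t : R) : C := (/ (RtoC rho * cis t))%C.

Lemma circle_neq0 t : (RtoC rho * cis t)%C <> 0.
Proof.
  apply: Cmult_neq_0; last exact: cis_neq0.
  by move=> /RtoC_inj; lra.
Qed.

Lemma Cmod_circle t : Cmod (RtoC rho * cis t) = rho.
Proof. by rewrite Cmod_mult Cmod_cis Cmod_R Rabs_pos_eq; lra. Qed.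

Lemma Cmod_einv t : Cmod (e t) = / rho.
Proof. by rewrite /e Cmod_inv ?Cmod_circle //; exact: circle_neq0. Qed.

Lemma pdiff_einv t : pdiff e t (- Ci * e t)%C.
Proof.
  have Hc := pdiff_scal (RtoC rho) _ _ _ (pdiff_cis t).
  have := pdiff_comp Cinv _ _ _ _ Hc (cdiff_Cinv _ (circle_neq0 t)).
  apply: pdiff_ext => //.
  rewrite /e; field; split; first exact: cis_neq0.
  by move=> /RtoC_inj; lra.
Qed.

Lemma ccont_einv t : ccont e t.
Proof. exact: pdiff_cont (pdiff_einv t). Qed.

Lemma is_CInt_einv_pow (n : nat) : is_CInt (fun t => e t ^ n.+1)%C 0 (2 * PI) 0.
Proof.
  have Hn : RtoC (INR n.+1) <> 0 by move=> /RtoC_inj; apply: not_0_INR.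
  apply: (is_CInt_closed_path (fun t => / (- Ci * RtoC (INR n.+1)) * e t ^ n.+1)%C).
  - move=> t.
    have := pdiff_scal (/ (- Ci * RtoC (INR n.+1)))%C _ _ _
      (pdiff_comp _ _ _ _ _ (pdiff_einv t) (cdiff_pow n (e t))).
    apply: pdiff_ext => //.
    rewrite Cpow_S; field; split=> //; exact: Ci_nz.
  - by move=> t; apply: ccont_pow; exact: ccont_einv.
  - by rewrite /e cis_2PI.
Qed.

(** The geometric series of the kernel is integrated term by term against [F]. When [F] is the
    restriction of a holomorphic function to the circle, $A_n$ is $2\pi$ times its $n$-th Taylor
    coefficient. *)
Lemma kernel_expansion (F : R -> C) (M : R) :
  (forall t, ccont F t) -> (forall t, Cmod (F t) <= M) ->
  exists A : nat -> C,
    (forall n, is_CInt (fun t => F t * e t ^ n)%C 0 (2 * PI) (A n)) /\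
    forall h, Cmod h < rho -> exists I : C,
      is_CInt (fun t => F t * (RtoC rho * cis t / (RtoC rho * cis t - h)))%C 0 (2 * PI) I /\
      forall N, Cmod (I - psum A h N) <= 2 * PI * (M * (Cmod h / rho) ^ N / (1 - Cmod h / rho)).
Proof.
  move=> HF HM.
  have HA n : exists l, is_CInt (fun t => F t * e t ^ n)%C 0 (2 * PI) l.
  { apply: ccont_ex_CInt => t; apply: ccont_mult => //.
    by apply: ccont_pow; exact: ccont_einv. }
  have [A HA'] : exists A : nat -> C,
    forall n, is_CInt (fun t => F t * e t ^ n)%C 0 (2 * PI) (A n).
  { exists (fun n => proj1_sig (constructive_indefinite_description _ (HA n))) => n.
    exact: proj2_sig (constructive_indefinite_description _ (HA n)). }
  move: {HA} HA' => HA.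
  exists A; split=> // h Hh.
  set q := Cmod h / rho.
  have Hq : 0 <= q < 1.
  { split; first by apply: Rdiv_le_0_compat; [exact: Cmod_ge_0 | lra].
    by apply/Rlt_div_l; lra. }
  pose k t : C := (RtoC rho * cis t / (RtoC rho * cis t - h))%C.
  have Hk t : ccont k t := ccont_ker h rho rho_gt0 Hh t.
  have Hr t : (RtoC rho * cis t - h)%C <> 0 := ray_neq0 h rho rho_gt0 Hh t.
  have Hkm t : Cmod (k t) <= / (1 - q).
  { rewrite /k Cmod_div // Cmod_circle.
    have Hge := ray_ge h rho rho_gt0 t.
    have -> : / (1 - q) = rho / (rho - Cmod h) by rewrite /q; field; lra.
    apply: Rmult_le_compat_l; first lra.
    by apply: Rinv_le_contravar; lra. }
  have HR N : exists l, is_CInt (fun t => F t * (h * e t) ^ N * k t)%C 0 (2 * PI) l.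
  { apply: ccont_ex_CInt => t; apply: ccont_mult => //; apply: ccont_mult => //.
    by apply: ccont_pow; apply: ccont_mult; [exact: ccont_const | exact: ccont_einv]. }
  have [I HI] := HR 0%nat.
  exists I; split.
  { by apply: is_CInt_ext HI => t; rewrite /k /=; ring. }
  (* The integral carrying the factor $(h/\zeta)^N$ is exactly the remainder after $N$ terms; the
     induction rests on $k=1+(h/\zeta)k$. *)
  have HD N l : is_CInt (fun t => F t * (h * e t) ^ N * k t)%C 0 (2 * PI) l ->
    I = (psum A h N + l)%C.
  { elim: N l => [|N IH] l Hl.
    - by rewrite (is_CInt_unique _ _ _ _ _ HI Hl) /=; ring.
    - have HN := is_CInt_scal (h ^ N)%C _ _ _ _ (HA N).
      rewrite (IH (h ^ N * A N + l)%C) /=; first by ring.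
      apply: is_CInt_ext (is_CInt_plus _ _ _ _ _ _ HN Hl) => t.
      rewrite Cpow_S Cpow_mult_l.
      have Ek : (k t = 1 + h * e t * k t)%C.
      { rewrite /k /e; field.
        by repeat split; first [exact: Hr | exact: cis_neq0 | move=> /RtoC_inj; lra]. }
      rewrite {2}Ek; ring. }
  move=> N; have [l Hl] := HR N.
  rewrite (HD N l Hl).
  have -> : (psum A h N + l - psum A h N = l)%C by ring.
  have HPI := PI_RGT_0.
  have -> : 2 * PI * (M * q ^ N / (1 - q)) = (2 * PI - 0) * (M * q ^ N / (1 - q)) by ring.
  apply: is_CInt_le Hl; first lra.
  move=> t; rewrite (Cmod_mult _ (k t)) (Cmod_mult (F t)) Cmod_pow Cmod_mult Cmod_einv.
  rewrite -/(Rdiv _ _) -/q.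
  have Hqn : 0 <= q ^ N by apply: pow_le; lra.
  have HFt := Cmod_ge_0 (F t); have Hkt := Cmod_ge_0 (k t).
  apply: Rmult_le_compat => //; [exact: Rmult_le_pos | exact: Rmult_le_compat_r].
Qed.

(** The expansion is applied to the constant 1. The powers $\zeta^{-n}$ with $n\ge 1$ have periodic
    primitives and integrate to zero, so the partial sums stay at $2\pi$ from the first term on, and
    the geometric error leaves no other value for the integral. *)
Lemma is_CInt_kernel (h : C) : Cmod h < rho ->
  is_CInt (fun t => RtoC rho * cis t / (RtoC rho * cis t - h))%C 0 (2 * PI) (RtoC (2 * PI)).
Proof.
  move=> Hh.
  have [|t|A [HA H]] := kernel_expansion (fun _ => 1) 1; first by move=> t; exact: ccont_const.
  { rewrite Cmod_1; lra. }
  have {H} [I [HI HN]] := H h Hh.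
  have A0 : A 0%nat = RtoC (2 * PI).
  { apply: is_CInt_unique (HA 0%nat) _.
    have := is_RInt_const (V := C_R_NormedModule) 0 (2 * PI) (RtoC 1).
    rewrite scal_R_Cmult -RtoC_mult Rminus_0_r Rmult_1_r.
    by apply: is_CInt_ext => t /=; ring. }
  have An n : A n.+1 = 0.
  { apply: is_CInt_unique (HA n.+1) _.
    by apply: is_CInt_ext (is_CInt_einv_pow n) => t; ring. }
  have HS N : psum A h N.+1 = RtoC (2 * PI).
  { elim: N => [|N IH]; first by rewrite /= A0; ring.
    have -> : psum A h N.+2 = (psum A h N.+1 + A N.+1 * h ^ N.+1)%C by [].
    by rewrite IH An; ring. }
  have E : I = RtoC (2 * PI).
  { apply/Ceq_minus; apply: Cmod_eq_0.
    apply: (le_geom_0 _ (2 * PI * / (1 - Cmod h / rho)) (Cmod h / rho)).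
    - exact: Cmod_ge_0.
    - split; first by apply: Rdiv_le_0_compat; [exact: Cmod_ge_0 | lra].
      by apply/Rlt_div_l; lra.
    - move=> N; have := HN N.+1; rewrite HS => HH.
      apply: (Rle_trans _ _ _ HH); right; rewrite /Rdiv; ring. }
  rewrite -E; apply: is_CInt_ext HI => t; ring.
Qed.

End Kernel.

(** The homotopy identifies Cauchy's integral with $2\pi f(w_0+h)$, and the expansion of the kernel
    yields the coefficients. The bounds are explicit in [M] because the function will depend on an
    integration variable in which [M] decays. *)
Lemma holo_taylor (f : C -> C) (w0 : C) (rho M : R) :
  0 < rho -> holo (fun z => Cmod (z - w0) < 4 * rho) f ->
  (forall z, Cmod (z - w0) = rho -> Cmod (f z) <= M) ->
  exists a : nat -> C, (forall n, Cmod (a n) * rho ^ n <= M) /\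
    forall h, Cmod h < rho -> forall N,
    Cmod (f (w0 + h)%C - psum a h N) <= M * (Cmod h / rho) ^ N / (1 - Cmod h / rho).
Proof.
  move=> Hrho [f' Hf] HM.
  pose F t := f (w0 + RtoC rho * cis t)%C.
  have Hin t : Cmod (w0 + RtoC rho * cis t - w0) = rho.
  { have -> : (w0 + RtoC rho * cis t - w0 = RtoC rho * cis t)%C by ring.
    exact: Cmod_circle. }
  have HF t : ccont F t.
  { apply: (ccont_comp (fun t => w0 + RtoC rho * cis t)%C f).
    - apply: ccont_plus; first exact: ccont_const.
      by apply: ccont_mult; [exact: ccont_const | exact: ccont_cis].
    - have [|Hd _] := Hf (w0 + RtoC rho * cis t)%C; last exact: cdiff_cont Hd.
      rewrite Hin; lra. }
  have HFM t : Cmod (F t) <= M by apply: HM; exact: Hin.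
  have [A [HA HI]] := kernel_expansion rho Hrho F M HF HFM.
  have HPI := PI_RGT_0.
  have H2PI : RtoC (2 * PI) <> 0 by move=> /RtoC_inj; lra.
  have HC h : Cmod h < rho ->
    is_CInt (fun t => F t * (RtoC rho * cis t / (RtoC rho * cis t - h)))%C 0 (2 * PI)
      (f (w0 + h) * RtoC (2 * PI))%C.
  { move=> Hh.
    have [I [HI1 _]] := HI h Hh.
    have HK := is_CInt_scal (f (w0 + h)%C) _ _ _ _ (is_CInt_kernel rho Hrho h Hh).
    suff -> : (f (w0 + h) * RtoC (2 * PI))%C = I by [].
    have Hpt1 t : (w0 + h + 1 * (RtoC rho * cis t - h) = w0 + RtoC rho * cis t)%C by ring.
    have Hpt0 t : (w0 + h + 0 * (RtoC rho * cis t - h) = w0 + h)%C by ring.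
    have [HI1r HI1i] := iffLR (is_CInt_pair _ _ _ _) HI1.
    have [HKr HKi] := iffLR (is_CInt_pair _ _ _ _) HK.
    apply: injective_projections.
    - rewrite -[LHS](is_RInt_unique _ _ _ _ HKr) -[RHS](is_RInt_unique _ _ _ _ HI1r).
      have := cauchy_homotopy f f' w0 h rho Hrho Hh Hf => Hh'.
      apply: etrans; last apply: etrans (esym Hh') _ => {Hh'}.
      + by apply: RInt_ext => t _; rewrite Hpt0.
      + by apply: RInt_ext => t _; rewrite Hpt1.
    - rewrite -[LHS](is_RInt_unique _ _ _ _ HKi) -[RHS](is_RInt_unique _ _ _ _ HI1i).
      (* The homotopy is applied a second time, to $-if$, for the imaginary parts. *)
      have Hf2 z : Cmod (z - w0) < 4 * rho ->
        cdiff (fun w => - Ci * f w)%C z (0 * f z + - Ci * f' z)%C /\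
        ccont (T := C_UniformSpace) (fun z => 0 * f z + - Ci * f' z)%C z.
      { move=> /Hf [H1 H2]; split; first exact: (cdiff_mult _ _ _ _ _ (cdiff_const _ _) H1).
        by apply: ccont_plus; apply: ccont_mult => //; try exact: ccont_const;
          exact: cdiff_cont H1. }
      have := cauchy_homotopy _ _ w0 h rho Hrho Hh Hf2 => Hh'.
      apply: etrans; last apply: etrans (esym Hh') _ => {Hh'}.
      + apply: RInt_ext => t _; rewrite Hpt0 Im_Re; congr Re; ring.
      + apply: RInt_ext => t _; rewrite Hpt1 Im_Re; congr Re; rewrite /F; ring. }
  exists (fun n => A n / RtoC (2 * PI))%C; split.
  - move=> n; rewrite Cmod_div // Cmod_R Rabs_pos_eq; last lra.
    have HAn : Cmod (A n) <= (2 * PI - 0) * (M * / rho ^ n).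
    { apply: is_CInt_le (HA n); first lra.
      move=> t; rewrite Cmod_mult Cmod_pow (Cmod_einv rho Hrho) pow_inv.
      apply: Rmult_le_compat_r => //; left; apply: Rinv_0_lt_compat; exact: pow_lt. }
    have Hp : 0 < rho ^ n by apply: pow_lt.
    have -> : Cmod (A n) / (2 * PI) * rho ^ n = Cmod (A n) * (rho ^ n / (2 * PI)) by field; lra.
    have -> : M = (2 * PI - 0) * (M * / rho ^ n) * (rho ^ n / (2 * PI)) by field; lra.
    apply: Rmult_le_compat_r => //; left; apply: Rdiv_lt_0_compat; lra.
  - move=> h Hh N.
    have [I [HI1 HI2]] := HI h Hh.
    have E := is_CInt_unique _ _ _ _ _ HI1 (HC h Hh).
    have HS : psum (fun n => A n / RtoC (2 * PI))%C h N = (psum A h N / RtoC (2 * PI))%C.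
    { elim: N => [|N IH] /=; first by field.
      by rewrite IH; field. }
    have := HI2 N; rewrite HS E.
    have -> : (f (w0 + h) * RtoC (2 * PI) - psum A h N =
      RtoC (2 * PI) * (f (w0 + h) - psum A h N / RtoC (2 * PI)))%C by field.
    rewrite Cmod_mult Cmod_R Rabs_pos_eq; last lra.
    by apply: Rmult_le_reg_l; lra.
Qed.

(** * Power series and the identity theorem *)

Definition cps (a : nat -> C) (h l : C) : Prop :=
  forall eps, 0 < eps -> exists N : nat, forall n : nat, (N <= n)%coq_nat ->
    Cmod (psum a h n - l) < eps.

Lemma pow_n_Cpow (h : C) (n : nat) : pow_n (K := C_Ring) h n = (h ^ n)%C.
Proof. by elim: n => [|n IH] //=; rewrite IH. Qed.

(** [sum_n] includes its last index and [psum] excludes it, hence the shift. *)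
Lemma sum_n_psum (a : nat -> C) (h : C) (n : nat) :
  sum_n (G := C_AbelianMonoid)
    (fun k => scal (K := C_Ring) (V := C_ModuleSpace) (pow_n (K := C_Ring) h k) (a k)) n =
  psum a h n.+1.
Proof.
  elim: n => [|n IH].
  - rewrite sum_O pow_n_Cpow.
    by change ((h ^ 0 * a 0%nat)%C = (0 + a 0%nat * h ^ 0)%C); ring.
  - rewrite sum_Sn IH pow_n_Cpow.
    change ((psum a h n.+1 + h ^ n.+1 * a n.+1)%C = (psum a h n.+1 + a n.+1 * h ^ n.+1)%C).
    by ring.
Qed.

Lemma is_pseries_cps (a : nat -> C) (h l : C) :
  is_pseries (K := C_AbsRing) (V := C_NormedModule) a h l <-> cps a h l.
Proof.
  split.
  - move=> H eps He.
    have /H [N HN] : locally (T := C_UniformSpace) l (fun w => Cmod (w - l) < eps).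
    { by apply/locally_Cmod; exists eps. }
    exists N.+1 => -[|n] Hn; first lia.
    rewrite -sum_n_psum; apply: HN; lia.
  - move=> H P /locally_Cmod [d [dp Hd]].
    have [N HN] := H d dp.
    exists N => n Hn; apply: Hd.
    have := HN n.+1 ltac:(lia); rewrite -sum_n_psum; apply.
Qed.

Lemma analytic_atP (F : C -> C) (w0 : C) :
  analytic_at F w0 <-> exists (a : nat -> C) (d : R),
    0 < d /\ forall h, Cmod h < d -> cps a h (F (w0 + h)%C).
Proof.
  split.
  - case=> a /locally_Cmod [d [dp H]]; exists a, d; split=> // h Hh.
    apply/is_pseries_cps.
    have := H (w0 + h)%C; have -> : (w0 + h - w0 = h)%C by ring.
    exact.
  - case=> a [d [dp H]]; exists a; apply/locally_Cmod; exists d; split=> // w Hw.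
    apply/is_pseries_cps.
    by have := H _ Hw; have -> : (w0 + (w - w0) = w)%C by ring.
Qed.

Lemma cps_plus a b h l m :
  cps a h l -> cps b h m -> cps (fun n => a n + b n)%C h (l + m)%C.
Proof.
  move=> Ha Hb eps He.
  have [N1 H1] := Ha (eps / 2) ltac:(lra).
  have [N2 H2] := Hb (eps / 2) ltac:(lra).
  exists (N1 + N2)%coq_nat => n Hn.
  have -> : psum (fun n => a n + b n)%C h n = (psum a h n + psum b h n)%C.
  { by elim: n {Hn} => [|n IH] /=; [ring | rewrite IH; ring]. }
  have -> : (psum a h n + psum b h n - (l + m) = (psum a h n - l) + (psum b h n - m))%C by ring.
  apply: (Rle_lt_trans _ _ _ (Cmod_triangle _ _)).
  have := H1 n ltac:(lia); have := H2 n ltac:(lia); lra.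
Qed.

Lemma cps_scal c a h l : cps a h l -> cps (fun n => c * a n)%C h (c * l)%C.
Proof.
  move=> Ha eps He.
  have Hc := Cmod_ge_0 c.
  have Hc1 : 0 < Cmod c + 1 by lra.
  have [N H] := Ha (eps / (Cmod c + 1)) (Rdiv_lt_0_compat _ _ He Hc1).
  exists N => n Hn.
  have -> : psum (fun n => c * a n)%C h n = (c * psum a h n)%C.
  { by elim: n {Hn} => [|n IH] /=; [ring | rewrite IH; ring]. }
  have -> : (c * psum a h n - c * l = c * (psum a h n - l))%C by ring.
  rewrite Cmod_mult.
  move: (H n Hn) => /(Rlt_div_r _ _ _ Hc1); have := Cmod_ge_0 (psum a h n - l); nra.
Qed.

Lemma analytic_plus F G w :
  analytic_at F w -> analytic_at G w -> analytic_at (fun z => F z + G z)%C w.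
Proof.
  move=> /analytic_atP [a [d [dp Ha]]] /analytic_atP [b [e [ep Hb]]].
  apply/analytic_atP; exists (fun n => a n + b n)%C, (Rmin d e); split.
  - exact: Rmin_glb_lt.
  - move=> h Hh; apply: cps_plus.
    + by apply: Ha; apply: (Rlt_le_trans _ _ _ Hh); apply: Rmin_l.
    + by apply: Hb; apply: (Rlt_le_trans _ _ _ Hh); apply: Rmin_r.
Qed.

Lemma analytic_scal c F w : analytic_at F w -> analytic_at (fun z => c * F z)%C w.
Proof.
  move=> /analytic_atP [a [d [dp Ha]]]; apply/analytic_atP.
  exists (fun n => c * a n)%C, d; split=> // h Hh; exact: cps_scal (Ha h Hh).
Qed.

Lemma analytic_ext F G w : (forall z, F z = G z) -> analytic_at F w -> analytic_at G w.
Proof.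
  move=> E [a H]; exists a; apply: filter_imp H => z; by rewrite E.
Qed.

Lemma analytic_minus F G w :
  analytic_at F w -> analytic_at G w -> analytic_at (fun z => F z - G z)%C w.
Proof.
  move=> HF HG.
  apply: (analytic_ext (fun z => F z + (- (1)) * G z)%C); first by move=> z; ring.
  by apply: analytic_plus => //; apply: analytic_scal.
Qed.

Lemma analytic_const0 w : analytic_at (fun _ => RtoC 0) w.
Proof.
  apply/analytic_atP; exists (fun _ => RtoC 0), 1; split; first lra.
  move=> h _ eps He; exists 0%nat => n _.
  have -> : psum (fun=> RtoC 0) h n = 0 by elim: n => [|n IH] //=; rewrite IH; ring.
  have -> : (0 - 0 = 0)%C by ring.
  by rewrite Cmod_0.
Qed.

Lemma analytic_Csum n (F : 'I_n -> C -> C) w :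
  (forall j, analytic_at (F j) w) -> analytic_at (fun z => Csum (fun j => F j z)) w.
Proof.
  rewrite /Csum; elim: n F => [|n IH] F HF.
  - apply: analytic_ext (analytic_const0 w) => z; by rewrite big_ord0.
  - have H := IH (fun j => F (lift ord0 j)) (fun j => HF _).
    apply: analytic_ext (analytic_plus _ _ _ (HF ord0) H) => z.
    by rewrite big_ord_recl.
Qed.

(** Reflections serve twice: with $c=2\ln\pi$ for the S-transformation in the variable $\log t$, and
    with $c=0$ to pass from the upper to the lower half of the strip. *)
Lemma analytic_reflect F c w : analytic_at F (c - w)%C -> analytic_at (fun z => F (c - z)%C) w.
Proof.
  move=> /analytic_atP [a [d [dp Ha]]]; apply/analytic_atP.
  exists (fun n => (- (1)) ^ n * a n)%C, d; split=> // h Hh eps He.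
  have [|N HN] := Ha (- h)%C _ eps He; first by rewrite Cmod_opp.
  exists N => n Hn.
  have -> : psum (fun n => (- (1)) ^ n * a n)%C h n = psum a (- h)%C n.
  { elim: n {Hn} => [|n IH] //=; rewrite IH.
    have -> : (- h = - (1) * h)%C by ring.
    by rewrite Cpow_mult_l; ring. }
  have -> : (c - (w + h) = c - w + - h)%C by ring.
  exact: HN.
Qed.

Lemma psum_tail_le (a : nat -> C) (h : C) (B q : R) (N k : nat) :
  0 <= q < 1 -> (forall n, Cmod (a n * h ^ n) <= B * q ^ n) ->
  Cmod (psum a h (k + N)%coq_nat - psum a h N) <= B * q ^ N / (1 - q).
Proof.
  move=> Hq Hb.
  have HB : 0 <= B.
  { have := Hb 0%nat; rewrite /= Rmult_1_r; have := Cmod_ge_0 (a 0%nat * 1)%C; lra. }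
  have Hn (n : nat) : 0 <= q ^ n by apply: pow_le; lra.
  (* Subtracting the geometric tail beyond [k + N] makes the bound telescope in the induction on
     [k]. *)
  suff H : Cmod (psum a h (k + N)%coq_nat - psum a h N) <=
    B * q ^ N / (1 - q) - B * q ^ (k + N)%coq_nat / (1 - q).
  { apply: (Rle_trans _ _ _ H).
    have : 0 <= B * q ^ (k + N)%coq_nat / (1 - q).
    { apply: Rdiv_le_0_compat; last lra. exact: Rmult_le_pos. }
    lra. }
  elim: k => [|k IH].
  - have -> : (psum a h N - psum a h N = 0)%C by ring.
    rewrite Cmod_0 /=; lra.
  - have -> : (psum a h (k.+1 + N)%coq_nat - psum a h N)%C =
      ((psum a h (k + N)%coq_nat - psum a h N) + a (k + N)%coq_nat * h ^ (k + N)%coq_nat)%C.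
    { by rewrite /=; ring. }
    apply: (Rle_trans _ _ _ (Cmod_triangle _ _)).
    have := Hb (k + N)%coq_nat.
    have E : B * q ^ (k.+1 + N)%coq_nat / (1 - q) =
      B * q ^ (k + N)%coq_nat / (1 - q) - B * q ^ (k + N)%coq_nat.
    { by rewrite /=; field; lra. }
    lra.
Qed.

(** A term is the difference of two consecutive partial sums, hence at most 2 in modulus once these
    are within 1 of the limit; finitely many terms remain. *)
Lemma cps_coef_bound a r l : 0 < r -> cps a (RtoC r) l ->
  exists B, forall n, Cmod (a n) * r ^ n <= B.
Proof.
  move=> Hr H.
  have [N HN] := H 1 ltac:(lra).
  have Hbig n : (N <= n)%coq_nat -> Cmod (a n) * r ^ n <= 2.
  { move=> Hn; have H1 := HN n Hn; have H2 := HN n.+1 ltac:(lia).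
    have -> : Cmod (a n) * r ^ n = Cmod (a n * RtoC r ^ n).
    { by rewrite Cmod_mult Cmod_pow Cmod_R Rabs_pos_eq; lra. }
    have -> : (a n * RtoC r ^ n = (psum a r n.+1 - l) - (psum a r n - l))%C by rewrite /=; ring.
    have := Cmod_sub_le (psum a r n.+1 - l) (psum a r n - l); lra. }
  have [B HB] : exists B, forall n, (n < N)%coq_nat -> Cmod (a n) * r ^ n <= B.
  { elim: N {HN Hbig} => [|N [B HB]]; first by exists 0 => n; lia.
    exists (Rmax B (Cmod (a N) * r ^ N)) => n Hn.
    case: (PeanoNat.Nat.eq_dec n N) => [->|Hne]; first exact: Rmax_r.
    apply: (Rle_trans _ _ _ (HB n _)); [lia | exact: Rmax_l]. }
  exists (Rmax B 2) => n.
  case: (Compare_dec.le_lt_dec N n) => Hn.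
  - by apply: (Rle_trans _ _ _ (Hbig n Hn)); apply: Rmax_r.
  - by apply: (Rle_trans _ _ _ (HB n Hn)); apply: Rmax_l.
Qed.

Lemma cps_tail a h l r B N : 0 < r -> Cmod h < r ->
  (forall n, Cmod (a n) * r ^ n <= B) -> cps a h l ->
  Cmod (l - psum a h N) <= B * (Cmod h / r) ^ N / (1 - Cmod h / r).
Proof.
  move=> Hr Hh HB Hl.
  have Hm := Cmod_ge_0 h.
  have Hq : 0 <= Cmod h / r < 1.
  { split; first by apply: Rdiv_le_0_compat.
    by apply/Rlt_div_l; lra. }
  have Hb n : Cmod (a n * h ^ n) <= B * (Cmod h / r) ^ n.
  { rewrite Cmod_mult Cmod_pow.
    have -> : Cmod (a n) * Cmod h ^ n = Cmod (a n) * r ^ n * (Cmod h / r) ^ n.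
    { rewrite Rmult_assoc -Rpow_mult_distr; congr (_ * _ ^ _); field; lra. }
    apply: Rmult_le_compat_r => //; apply: pow_le; lra. }
  apply: le_epsilon => eps He.
  have [K HK] := Hl eps He.
  have H1 := HK (K + N)%coq_nat ltac:(lia).
  have H2 := psum_tail_le a h B _ N K Hq Hb.
  have := Cmod_triangle3 l (psum a h (K + N)%coq_nat) (psum a h N).
  rewrite (Cmod_minus_sym l (psum a h (K + N)%coq_nat)); lra.
Qed.

(** All coefficients vanish, by strong induction. If the earlier ones do, a zero $w_0+h$ of [F]
    makes $a_nh^n$ equal, up to sign, to the tail of the series, whence $|a_n|\le 2B|h|/r^{n+1}$
    with $|h|$ as small as desired. *)
Lemma analytic_zero_acc F w0 : analytic_at F w0 ->
  (forall d, 0 < d -> exists w, [/\ w <> w0, Cmod (w - w0) < d & F w = 0]) ->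
  exists d, 0 < d /\ forall w, Cmod (w - w0) < d -> F w = 0.
Proof.
  move=> /analytic_atP [a [d [dp Ha]]] Hacc.
  have [B HB] : exists B, forall n, Cmod (a n) * (d / 2) ^ n <= B.
  { apply: (cps_coef_bound a (d / 2) (F (w0 + RtoC (d / 2))%C)); first lra.
    apply: Ha; rewrite Cmod_R Rabs_pos_eq; lra. }
  have HB0 : 0 <= B.
  { have := HB 0%nat; rewrite /= Rmult_1_r; have := Cmod_ge_0 (a 0%nat); lra. }
  set r := d / 2 in HB.
  have Hr : 0 < r by rewrite /r; lra.
  have Ha0 n : a n = 0.
  { induction n as [n Hlt] using (well_founded_induction Wf_nat.lt_wf).
    have HS h k : (k <= n)%coq_nat -> psum a h k = 0.
    { by elim: k => [|k IHk] Hk //=; rewrite IHk ?Hlt; [ring | lia | lia]. }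
    apply: Cmod_eq_0; apply: Rle_antisym; last exact: Cmod_ge_0.
    apply: le_epsilon => eps He; rewrite Rplus_0_l.
    have Hrn : 0 < r ^ n.+1 by apply: pow_lt.
    (* The divisor [2 * B + 1] stays positive even when [B] is zero. *)
    have Hd' : 0 < Rmin (r / 2) (eps * r ^ n.+1 / (2 * B + 1)).
    { by apply: Rmin_glb_lt; [lra | apply: Rdiv_lt_0_compat; [exact: Rmult_lt_0_compat | lra]]. }
    have [w [Hw0 Hw Fw]] := Hacc _ Hd'.
    have H1 : Cmod (w - w0) < r / 2 by apply: (Rlt_le_trans _ _ _ Hw); exact: Rmin_l.
    have H2 : Cmod (w - w0) * (2 * B + 1) < eps * r ^ n.+1.
    { by apply/Rlt_div_r; [lra | apply: (Rlt_le_trans _ _ _ Hw); exact: Rmin_r]. }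
    have Hpos : 0 < Cmod (w - w0) by apply/Cmod_gt_0; exact: Cminus_eq_contra.
    have Hcps := Ha (w - w0)%C ltac:(rewrite /r in H1; lra).
    have Ew : (w0 + (w - w0) = w)%C by ring.
    rewrite Ew Fw in Hcps.
    have Hlt' : Cmod (w - w0) < r by lra.
    have := cps_tail a (w - w0)%C 0 r B n.+1 Hr Hlt' HB Hcps.
    have -> : psum a (w - w0)%C n.+1 = (a n * (w - w0) ^ n)%C by rewrite /= HS //; ring.
    have -> : (0 - a n * (w - w0) ^ n = - (a n * (w - w0) ^ n))%C by ring.
    rewrite Cmod_opp Cmod_mult Cmod_pow.
    move: (Cmod (w - w0)) Hpos H1 H2 => m Hpos H1 H2 H3.
    have Hq : m / r <= / 2 by apply/Rle_div_l; lra.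
    have Hmn : 0 < m ^ n by apply: pow_lt.
    have H4 : B * (m / r) ^ n.+1 / (1 - m / r) <= 2 * B * (m / r) ^ n.+1.
    { have Hp : 0 <= B * (m / r) ^ n.+1.
      { apply: Rmult_le_pos => //; apply: pow_le; apply: Rdiv_le_0_compat; lra. }
      apply/Rle_div_l; [lra | nra]. }
    have H5 : Cmod (a n) * m ^ n <= 2 * B * m / r ^ n.+1 * m ^ n.
    { apply: (Rle_trans _ _ _ H3); apply: (Rle_trans _ _ _ H4); right.
      rewrite /Rdiv Rpow_mult_distr pow_inv /=; field; split; [apply: pow_nonzero; lra | lra]. }
    have H6 : Cmod (a n) <= 2 * B * m / r ^ n.+1 by apply: Rmult_le_reg_r H5.
    apply: (Rle_trans _ _ _ H6); apply/Rle_div_l => //; nra. }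
  exists d; split=> // w Hw.
  have := Ha (w - w0)%C Hw.
  have -> : (w0 + (w - w0) = w)%C by ring.
  move=> Hc; apply: Cmod_eq_0; apply: Rle_antisym; last exact: Cmod_ge_0.
  apply: le_epsilon => eps He; rewrite Rplus_0_l.
  have [N HN] := Hc eps He.
  have := HN N (PeanoNat.Nat.le_refl N).
  have -> : psum a (w - w0)%C N = 0.
  { by elim: N {HN} => [|N IH] //=; rewrite IH Ha0; ring. }
  have -> : (0 - F w = - F w)%C by ring.
  rewrite Cmod_opp; lra.
Qed.

(** A connectedness argument on the vertical segment above [x]. Let [s] be the supremum of the
    heights up to which [F] vanishes near every point. Zeros accumulate at height [s], so [F]
    vanishes on a disc there; if [s] were below [y], that disc would reach higher heights. *)
Lemma identity_upper (F : C -> C) (Y x y : R) :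
  (forall w, Rabs (Im w) < Y -> analytic_at F w) ->
  (forall u : R, F (RtoC u) = 0) -> 0 <= y < Y -> F (x, y) = 0.
Proof.
  move=> Han Hz Hy.
  pose flat v := exists d, 0 < d /\ forall w, Cmod (w - (x, v)) < d -> F w = 0.
  pose E v := 0 <= v <= y /\ forall u, 0 <= u <= v -> flat u.
  have Hflat v : 0 <= v <= y ->
    (forall d, 0 < d -> exists w, [/\ w <> (x, v), Cmod (w - (x, v)) < d & F w = 0]) -> flat v.
  { by move=> Hv; apply: analytic_zero_acc; apply: Han; rewrite /= Rabs_pos_eq; lra. }
  have H0 : E 0.
  { split; first lra. move=> u Hu; have -> : u = 0 by lra.
    apply: Hflat; first lra.
    (* At height 0 the real axis itself supplies the accumulating zeros. *)
    move=> d dp; exists (RtoC (x + d / 2)); split=> //.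
    - by case; lra.
    - have -> : (RtoC (x + d / 2) - (x, 0) = RtoC (d / 2))%C.
      { by rewrite /RtoC /Cminus /Cplus /Copp /=; congr pair; ring. }
      by rewrite Cmod_R Rabs_pos_eq; lra. }
  have [s [Hub Hlub]] : {s | is_lub E s}.
  { by apply: completeness; [exists y => v [Hv _]; lra | exists 0]. }
  have Hs : 0 <= s <= y.
  { split; first exact: Hub. by apply: Hlub => v [Hv _]; lra. }
  have Hbelow u : 0 <= u < s -> flat u.
  { move=> Hu.
    have [v [[Hv Hvf] Huv]] : exists v, E v /\ u < v.
    { apply: NNPP => Hno.
      have : s <= u; last lra.
      apply: Hlub => v Hv; apply: Rnot_lt_le => Huv; apply: Hno; by exists v. }
    apply: Hvf; lra. }
  have Hvert (u v : R) : Cmod ((x, u) - (x, v)) = Rabs (u - v).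
  { have -> : ((x, u) - (x, v) = RtoC (u - v) * Ci)%C.
    { by rewrite /RtoC /Ci /Cmult /Cminus /Cplus /Copp /=; congr pair; ring. }
    by rewrite Cmod_mult Cmod_Ci Cmod_R Rmult_1_r. }
  have Hsf : flat s.
  { case: (Req_dec s 0) => [->|Hs0]; first by apply: (proj2 H0); lra.
    apply: Hflat => // d dp.
    have Hd : 0 < Rmin s (d / 2) by apply: Rmin_glb_lt; lra.
    have Hd1 := Rmin_l s (d / 2); have Hd2 := Rmin_r s (d / 2).
    exists (x, s - Rmin s (d / 2)); split.
    - by case; lra.
    - rewrite Hvert; apply/Rabs_lt_between; lra.
    - have [|e [ep He]] := Hbelow (s - Rmin s (d / 2)); first lra.
      apply: He; rewrite Hvert.
      have -> : s - Rmin s (d / 2) - (s - Rmin s (d / 2)) = 0 by ring.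
      by rewrite Rabs_R0. }
  have [d [dp Hd]] := Hsf.
  case: (Rle_lt_dec y s) => Hys.
  - apply: Hd; rewrite Hvert; have -> : y - s = 0 by lra.
    by rewrite Rabs_R0.
  - exfalso.
    have Hm : 0 < Rmin (y - s) (d / 2) by apply: Rmin_glb_lt; lra.
    have Hm1 := Rmin_l (y - s) (d / 2); have Hm2 := Rmin_r (y - s) (d / 2).
    have : E (s + Rmin (y - s) (d / 2)).
    { split; first lra. move=> u Hu.
      case: (Rlt_le_dec u s) => Hus; first by apply: Hbelow; lra.
      exists (d / 2); split; first lra.
      move=> w Hw; apply: Hd.
      apply: (Rle_lt_trans _ _ _ (Cmod_triangle3 w (x, u) (x, s))).
      have : Rabs (u - s) <= d / 2 by apply/Rabs_le_between; lra.
      rewrite Hvert; lra. }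
    move=> /Hub; lra.
Qed.

(** The lower half of the strip follows from the upper one by $z\mapsto -z$, which preserves the
    real axis. *)
Lemma identity_strip (F G : C -> C) (Y : R) (w : C) :
  (forall w, Rabs (Im w) < Y -> analytic_at F w) ->
  (forall w, Rabs (Im w) < Y -> analytic_at G w) ->
  (forall u : R, F (RtoC u) = G (RtoC u)) -> Rabs (Im w) < Y -> F w = G w.
Proof.
  move=> HF HG E; case: w => x y /= Hy.
  pose D z := (F z - G z)%C.
  have HD z : Rabs (Im z) < Y -> analytic_at D z.
  { by move=> Hz; apply: analytic_minus; [exact: HF | exact: HG]. }
  have HD0 (u : R) : D (RtoC u) = 0 by rewrite /D E; ring.
  suff HD1 : D (x, y) = 0 by apply/Ceq_minus.
  case: (Rle_dec 0 y) => Hy0.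
  - by apply: (identity_upper D Y) => //; rewrite Rabs_pos_eq in Hy; lra.
  - have : (fun z => D (0 - z)%C) (- x, - y) = 0.
    { apply: (identity_upper (fun z => D (0 - z)%C) Y).
      - move=> z Hz; apply: (analytic_reflect D 0 z); apply: HD.
        have -> : Im (0 - z) = - Im z by rewrite /Im /=; ring.
        by rewrite Rabs_Ropp.
      - by move=> u; rewrite -RtoC_minus.
      - by rewrite Rabs_left in Hy; lra. }
    have -> : Cminus 0 (- x, - y) = (x, y).
    { by rewrite /RtoC /Cminus /Cplus /Copp /=; congr pair; ring. }
    by [].
Qed.

(** * Integrals over the half-line depending on a complex parameter *)

Definition is_CInt_oo (f : R -> C) (l : C) : Prop :=
  forall eps, 0 < eps -> exists S0, forall S, S0 < S ->
    exists y, is_CInt f 0 S y /\ Cmod (y - l) < eps.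

Lemma is_CInt_oo_unique f l : is_CInt_oo f l -> Cint_0_oo f = l.
Proof.
  move=> H; rewrite /Cint_0_oo.
  apply (@is_RInt_gen_unique C_R_CompleteNormedModule (at_point 0) (Rbar_locally p_infty)
    (Proper_StrongProper _ (at_point_filter (0 : R)))
    (Proper_StrongProper _ (Rbar_locally_filter p_infty)) f l).
  move=> P /locally_Cmod [d [dp Hd]].
  have [S0 HS] := H d dp.
  apply: (Filter_prod _ _ _ (fun x => x = 0) (fun S => S0 < S)) => //; first by exists S0.
  move=> x S -> {}/HS [y [Hy1 Hy2]].
  by exists y; split=> //; apply: Hd.
Qed.

Lemma is_CInt_oo_plus f g l m :
  is_CInt_oo f l -> is_CInt_oo g m -> is_CInt_oo (fun s => f s + g s)%C (l + m)%C.
Proof.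
  move=> Hf Hg eps He.
  have [S1 H1] := Hf (eps / 2) ltac:(lra).
  have [S2 H2] := Hg (eps / 2) ltac:(lra).
  exists (Rmax S1 S2) => S HS.
  have [y1 [Hy1 Hy1']] := H1 S (Rle_lt_trans _ _ _ (Rmax_l _ _) HS).
  have [y2 [Hy2 Hy2']] := H2 S (Rle_lt_trans _ _ _ (Rmax_r _ _) HS).
  exists (y1 + y2)%C; split; first exact: is_CInt_plus.
  have -> : (y1 + y2 - (l + m) = (y1 - l) + (y2 - m))%C by ring.
  apply: (Rle_lt_trans _ _ _ (Cmod_triangle _ _)); lra.
Qed.

Lemma is_CInt_oo_scal c f l : is_CInt_oo f l -> is_CInt_oo (fun s => c * f s)%C (c * l)%C.
Proof.
  move=> Hf eps He.
  have Hc := Cmod_ge_0 c.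
  have Hc1 : 0 < Cmod c + 1 by lra.
  have [S0 H] := Hf (eps / (Cmod c + 1)) (Rdiv_lt_0_compat _ _ He Hc1).
  exists S0 => S /H [y [Hy1 Hy2]]; exists (c * y)%C; split; first exact: is_CInt_scal.
  have -> : (c * y - c * l = c * (y - l))%C by ring.
  rewrite Cmod_mult.
  move: Hy2 => /(Rlt_div_r _ _ _ Hc1); have := Cmod_ge_0 (y - l); nra.
Qed.

(** Positive [s] suffice, so the value of a quotient of hyperbolic sines at 0 is immaterial. *)
Lemma is_CInt_oo_ext f g l :
  (forall s, 0 < s -> f s = g s) -> is_CInt_oo f l -> is_CInt_oo g l.
Proof.
  move=> E Hf eps He; have [S0 H] := Hf eps He.
  exists (Rmax S0 0) => S HS.
  have [y [Hy1 Hy2]] := H S (Rle_lt_trans _ _ _ (Rmax_l _ _) HS).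
  have HS0 := Rle_lt_trans _ _ _ (Rmax_r S0 0) HS.
  exists y; split=> //; apply: is_RInt_ext Hy1 => s; rewrite Rmin_left; last lra.
  by move=> [Hs _]; apply: E.
Qed.

Lemma is_CInt_exp_le f (a b A : R) l : a <= b ->
  (forall s, a <= s -> Cmod (f s) <= A * exp (- s)) -> is_CInt f a b l ->
  Cmod l <= A * exp (- a) - A * exp (- b).
Proof.
  move=> Hab Hf Hl; rewrite -norm_Cmod.
  apply: (norm_RInt_le f (fun s => A * exp (- s)) a b _ _ Hab _ Hl).
  - by move=> s [Hs _]; rewrite norm_Cmod; apply: Hf.
  - have -> : A * exp (- a) - A * exp (- b) = minus (- A * exp (- b)) (- A * exp (- a)).
    { by rewrite /minus /plus /opp /=; ring. }
    apply: (is_RInt_derive (fun s => - A * exp (- s))) => s _.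
    + by auto_derive => //; ring.
    + apply: (ex_derive_continuous (fun s => A * exp (- s))); by auto_derive.
Qed.

(** Tails are bounded by $Ae^{-S}$, so the truncated integrals satisfy Cauchy's criterion; the limit
    is at most $A$ because $e^{-s}$ has integral 1. *)
Lemma dominated_CInt_oo f A :
  (forall s, ccont f s) -> (forall s, 0 <= s -> Cmod (f s) <= A * exp (- s)) ->
  exists l, is_CInt_oo f l /\ Cmod l <= A.
Proof.
  move=> Hc Hf.
  have HA : 0 <= A.
  { have := Hf 0 (Rle_refl 0); rewrite Ropp_0 exp_0; have := Cmod_ge_0 (f 0); lra. }
  have Hex a b : exists l, is_CInt f a b l by apply: ccont_ex_CInt.
  pose I S : C := RInt (V := C_R_CompleteNormedModule) f 0 S.
  have HI S : is_CInt f 0 S (I S).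
  { by apply: (RInt_correct (V := C_R_CompleteNormedModule)); apply: Hex. }
  have Hdiff S T : 0 <= S <= T -> Cmod (I T - I S) <= A * exp (- S).
  { move=> HST; have [d Hd] := Hex S T.
    have HT := is_RInt_Chasles (V := C_R_NormedModule) _ _ _ _ _ _ (HI S) Hd.
    have -> : (I T - I S = d)%C.
    { rewrite (is_CInt_unique _ _ _ _ _ (HI T) HT).
      by change ((I S + d - I S)%C = d); ring. }
    have : Cmod d <= A * exp (- S) - A * exp (- T).
    { by apply: is_CInt_exp_le Hd => [|s Hs]; [lra | apply: Hf; lra]. }
    have := exp_pos (- T); nra. }
  have Hsmall eps : 0 < eps -> exists S0, 0 <= S0 /\ forall S, S0 < S -> A * exp (- S) < eps.
  (* $Ae^{-S}\le A/(1+S)<\varepsilon$ as soon as $S>A/\varepsilon$. *)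
  { move=> He; exists (A / eps); split; first by apply: Rdiv_le_0_compat.
    move=> S HS.
    have HS' : A < S * eps by apply/Rlt_div_l.
    have H1 := exp_ineq1_le S.
    have H2 : exp S * exp (- S) = 1 by rewrite -exp_plus Rplus_opp_r exp_0.
    have H3 := exp_pos S; have H4 := exp_pos (- S).
    have H5 : A < exp S * eps by nra.
    have -> : eps = exp S * eps * exp (- S).
    { by rewrite Rmult_assoc (Rmult_comm eps) -Rmult_assoc H2; ring. }
    exact: Rmult_lt_compat_r. }
  have [l Hl] : exists l : C_R_CompleteNormedModule,
    filterlim I (Rbar_locally p_infty) (locally l).
  { apply/filterlim_locally_cauchy => eps.
    have [S0 [HS0 HS]] := Hsmall eps (cond_pos eps).
    exists (fun S => S0 < S); split; first by exists S0.
    have Hsym (u v : R) : S0 < u -> u <= v -> Cmod (I v - I u) < eps.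
    { move=> Hu Huv; apply: (Rle_lt_trans _ (A * exp (- u))); last exact: HS.
      apply: Hdiff; lra. }
    move=> u v Hu Hv; apply: C_NormedModule_mixin_compat1.
    change (Cmod (I v - I u) < eps).
    case: (Rle_dec u v) => Huv; first exact: Hsym.
    rewrite Cmod_minus_sym; apply: Hsym => //; lra. }
  have Hlim eps : 0 < eps -> exists S0, forall S, S0 < S -> Cmod (I S - l) < eps.
  { move=> He.
    apply: (Hl (fun z => Cmod (z - l) < eps)).
    by apply/locally_Cmod; exists eps. }
  exists l; split.
  - move=> eps He; have [S0 HS0] := Hlim eps He; exists S0 => S HS.
    by exists (I S); split; [exact: HI | exact: HS0].
  - apply: le_epsilon => eps He; have [S0 HS0] := Hlim eps He.
    have HS : S0 < Rmax 0 S0 + 1 by have := Rmax_r 0 S0; lra.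
    have HS' : 0 <= Rmax 0 S0 + 1 by have := Rmax_l 0 S0; lra.
    have H1 := HS0 _ HS.
    have H2 : Cmod (I (Rmax 0 S0 + 1)) <= A * exp (- 0) - A * exp (- (Rmax 0 S0 + 1)).
    { by apply: is_CInt_exp_le (HI _) => // s Hs; apply: Hf. }
    have := Cmod_le_plus l (I (Rmax 0 S0 + 1)).
    rewrite Cmod_minus_sym; rewrite Ropp_0 exp_0 in H2.
    have := exp_pos (- (Rmax 0 S0 + 1)); nra.
Qed.

Lemma ccont_unif_limit {T : UniformSpace} (f : T -> C) (x : T) :
  (forall eps, 0 < eps -> exists g : T -> C,
     ccont g x /\ forall y, Cmod (f y - g y) <= eps) -> ccont f x.
Proof.
  move=> H eps He.
  have He3 : 0 < eps / 3 by lra.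
  have [g [Hg Hfg]] := H (eps / 3) He3.
  apply: filter_imp (Hg (eps / 3) He3) => y Hy.
  have := Cmod_triangle3 (f y) (g y) (f x).
  have := Cmod_triangle3 (g y) (g x) (f x).
  have := Hfg y; have := Hfg x; rewrite (Cmod_minus_sym (f x)); lra.
Qed.

(** The coefficients are obtained separately for each [s], so their continuity in [s] has to be
    recovered. By induction on [n], $a_n$ is the uniform limit, as $h\to 0$, of $K(w_0+h)$ minus its
    first $n$ Taylor terms, divided by $h^n$; the error is at most $2Ah/\rho^{n+1}$ for
    $h\le\rho/2$. *)
Lemma taylor_coef_ccont (K : C -> R -> C) (a : R -> nat -> C) (w0 : C) (rho A : R) :
  0 < rho -> (forall w s, Cmod (w - w0) < rho -> ccont (K w) s) ->
  (forall s h, Cmod h < rho -> forall N,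
     Cmod (K (w0 + h)%C s - psum (a s) h N) <= A * (Cmod h / rho) ^ N / (1 - Cmod h / rho)) ->
  forall n s, ccont (fun s => a s n) s.
Proof.
  move=> Hrho HK Ha n.
  have HA : 0 <= A.
  { have := Ha 0 (RtoC 0) _ 0%nat; rewrite Cmod_0 => /(_ Hrho).
    have := Cmod_ge_0 (K (w0 + 0)%C 0 - psum (a 0) (RtoC 0) 0).
    have -> : A * (0 / rho) ^ 0 / (1 - 0 / rho) = A by rewrite /=; field; lra.
    lra. }
  induction n as [n IH] using (well_founded_induction Wf_nat.lt_wf) => s.
  have Hps h k : (k <= n)%coq_nat -> ccont (fun s => psum (a s) h k) s.
  { elim: k => [|k IHk] Hk; first exact: ccont_const.
    apply: (ccont_plus (fun s => psum (a s) h k)); first by apply: IHk; lia.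
    by apply: ccont_mult; [apply: IH; lia | exact: ccont_const]. }
  apply: ccont_unif_limit => eps He.
  have Hrn : 0 < rho ^ n.+1 by apply: pow_lt.
  pose h := Rmin (rho / 2) (eps * rho ^ n.+1 / (2 * A + 1)).
  have Hh : 0 < h.
  { by apply: Rmin_glb_lt; [lra | apply: Rdiv_lt_0_compat; [exact: Rmult_lt_0_compat | lra]]. }
  have Hh1 : h <= rho / 2 by apply: Rmin_l.
  have Hh2 : h * (2 * A + 1) <= eps * rho ^ n.+1.
  { by apply/Rle_div_r; [lra | exact: Rmin_r]. }
  have Hmod : Cmod (RtoC h) = h by rewrite Cmod_R Rabs_pos_eq; lra.
  have Hmlt : Cmod (RtoC h) < rho by lra.
  have Hhn : (RtoC h ^ n)%C <> 0 by apply: Cpow_nz => /RtoC_inj; lra.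
  exists (fun s => (K (w0 + RtoC h)%C s - psum (a s) (RtoC h) n) * / (RtoC h ^ n))%C; split.
  - apply: ccont_mult; last exact: ccont_const.
    apply: ccont_minus; last by apply: Hps; lia.
    apply: HK.
    by have -> : (w0 + RtoC h - w0 = RtoC h)%C by ring.
  - move=> t.
    have := Ha t (RtoC h) Hmlt n.+1; rewrite Hmod => H1.
    have -> : (a t n - (K (w0 + RtoC h) t - psum (a t) (RtoC h) n) * / (RtoC h ^ n) =
      - ((K (w0 + RtoC h) t - psum (a t) (RtoC h) n.+1) / RtoC h ^ n))%C.
    { by rewrite /=; field. }
    rewrite Cmod_opp Cmod_div // Cmod_pow Hmod.
    have Hp : 0 < h ^ n by apply: pow_lt.
    apply/Rle_div_l => //; apply: (Rle_trans _ _ _ H1).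
    have Hq : h / rho <= / 2 by apply/Rle_div_l; lra.
    have Hqp : 0 <= A * (h / rho) ^ n.+1.
    { apply: Rmult_le_pos => //; apply: pow_le; apply: Rdiv_le_0_compat; lra. }
    apply: (Rle_trans _ (2 * A * (h / rho) ^ n.+1)).
    { by apply/Rle_div_l; [lra | nra]. }
    have -> : 2 * A * (h / rho) ^ n.+1 = 2 * A * h / rho ^ n.+1 * h ^ n.
    { rewrite /Rdiv Rpow_mult_distr pow_inv /=; field; split; [apply: pow_nonzero; lra | lra]. }
    apply: Rmult_le_compat_r; first lra.
    apply/Rle_div_l => //; nra.
Qed.

(** The remainder after $N$ terms is dominated by $\frac{Aq^N}{1-q}e^{-s}$ with $q=|h|/\rho$, so
    exchanging sum and integral takes finite sums and one estimate. The bound in $|s|$, valid at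
    every real $s$, makes the coefficients continuous on both sides of 0. *)
Lemma analytic_integral (K : C -> R -> C) (w0 : C) (rho A : R) :
  0 < rho ->
  (forall s, holo (fun z => Cmod (z - w0) < 4 * rho) (fun w => K w s)) ->
  (forall w s, Cmod (w - w0) <= rho -> ccont (K w) s) ->
  (forall w s, Cmod (w - w0) <= rho -> Cmod (K w s) <= A * exp (- Rabs s)) ->
  analytic_at (fun w => Cint_0_oo (K w)) w0.
Proof.
  move=> Hrho Hh Hc Hb.
  have [a Ha] : exists a : R -> nat -> C, forall s,
    (forall n, Cmod (a s n) * rho ^ n <= A * exp (- Rabs s)) /\
    forall h, Cmod h < rho -> forall N,
    Cmod (K (w0 + h)%C s - psum (a s) h N) <=
      A * exp (- Rabs s) * (Cmod h / rho) ^ N / (1 - Cmod h / rho).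
  { have H s := holo_taylor _ _ _ _ Hrho (Hh s) (fun z Hz => Hb z s (Req_le _ _ Hz)).
    exists (fun s => proj1_sig (constructive_indefinite_description _ (H s))) => s.
    exact: proj2_sig (constructive_indefinite_description _ (H s)). }
  have Hexp s : exp (- Rabs s) <= 1.
  { rewrite -exp_0; apply: exp_le_compat; have := Rabs_pos s; lra. }
  have HA : 0 <= A.
  { have := Hb w0 0; have -> : (w0 - w0 = 0)%C by ring.
    rewrite Cmod_0 Rabs_R0 Ropp_0 exp_0 Rmult_1_r => /(_ (Rlt_le _ _ Hrho)).
    have := Cmod_ge_0 (K w0 0); lra. }
  have Hq h : Cmod h < rho -> 0 <= Cmod h / rho < 1.
  { move=> Hlt; split; first by apply: Rdiv_le_0_compat => //; exact: Cmod_ge_0.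
    by apply/Rlt_div_l; lra. }
  have Hac n s : ccont (fun s => a s n) s.
  { apply: (taylor_coef_ccont K a w0 rho A Hrho).
    - by move=> w t Hw; apply: Hc; lra.
    - move=> t h Hlt N; apply: (Rle_trans _ _ _ (proj2 (Ha t) h Hlt N)).
      have Hqh := Hq h Hlt.
      have HqN : 0 <= (Cmod h / rho) ^ N by apply: pow_le; lra.
      apply: Rmult_le_compat_r; first by left; apply: Rinv_0_lt_compat; lra.
      apply: Rmult_le_compat_r => //; have := Hexp t; nra. }
  have [I HI] : exists I : nat -> C, forall n, is_CInt_oo (fun s => a s n) (I n).
  { have H n : exists l, is_CInt_oo (fun s => a s n) l.
    { have Hp : 0 < rho ^ n by apply: pow_lt.
      have [|s Hs|l [Hl _]] := dominated_CInt_oo (fun s => a s n) (A / rho ^ n).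
      - exact: Hac.
      - have := proj1 (Ha s) n; rewrite Rabs_pos_eq // => H.
        have -> : A / rho ^ n * exp (- s) = A * exp (- s) / rho ^ n by field; lra.
        exact/Rle_div_r.
      - by exists l. }
    exists (fun n => proj1_sig (constructive_indefinite_description _ (H n))) => n.
    exact: proj2_sig (constructive_indefinite_description _ (H n)). }
  have Hps h N : is_CInt_oo (fun s => psum (a s) h N) (psum I h N).
  { elim: N => [|N IH].
    - have [|s Hs|l [Hl Hl0]] := dominated_CInt_oo (fun _ => RtoC 0) 0.
      + by move=> s; exact: ccont_const.
      + by rewrite Cmod_0; lra.
      + have <- : l = psum I h 0 by apply: Cmod_eq_0; have := Cmod_ge_0 l; lra.
        exact: Hl.
    - have -> : psum I h N.+1 = (psum I h N + h ^ N * I N)%C by rewrite /=; ring.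
      apply: (is_CInt_oo_plus (fun s => psum (a s) h N)) => //.
      apply: is_CInt_oo_ext (is_CInt_oo_scal (h ^ N)%C _ _ (HI N)) => s _.
      by ring. }
  apply/analytic_atP; exists I, rho; split=> // h Hlt.
  have Hqh := Hq h Hlt.
  have Hin : Cmod (w0 + h - w0) <= rho.
  { have -> : (w0 + h - w0 = h)%C by ring. lra. }
  have [|s Hs|J [HJ _]] := dominated_CInt_oo (K (w0 + h)%C) A.
  - by move=> s; exact: Hc.
  - by have := Hb _ s Hin; rewrite (Rabs_pos_eq s).
  rewrite (is_CInt_oo_unique _ _ HJ).
  have Herr N : Cmod (psum I h N - J) <= A / (1 - Cmod h / rho) * (Cmod h / rho) ^ N.
  { have Hdiff := is_CInt_oo_plus _ _ _ _ (Hps h N) (is_CInt_oo_scal (- (1))%C _ _ HJ).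
    have [|s Hs|l [Hl Hl0]] := dominated_CInt_oo
      (fun s => psum (a s) h N + - (1) * K (w0 + h) s)%C
      (A / (1 - Cmod h / rho) * (Cmod h / rho) ^ N).
    - move=> s; apply: ccont_plus; last by apply: ccont_mult; [exact: ccont_const | exact: Hc].
      elim: N {Hdiff} => [|N IH]; first exact: ccont_const.
      apply: (ccont_plus (fun s => psum (a s) h N)) => //.
      by apply: ccont_mult; [exact: Hac | exact: ccont_const].
    - have := proj2 (Ha s) h Hlt N; rewrite (Rabs_pos_eq s Hs) Cmod_minus_sym => H.
      have -> : (psum (a s) h N + - (1) * K (w0 + h) s = psum (a s) h N - K (w0 + h) s)%C by ring.
      apply: (Rle_trans _ _ _ H); right; field; split; lra.
    - have E : l = (psum I h N - J)%C.
      { by rewrite -(is_CInt_oo_unique _ _ Hl) (is_CInt_oo_unique _ _ Hdiff); ring. }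
      by rewrite -E. }
  move=> eps He.
  have Habs : Rabs (Cmod h / rho) < 1 by rewrite Rabs_pos_eq; lra.
  have HA1 : 0 < A / (1 - Cmod h / rho) + 1.
  { have : 0 <= A / (1 - Cmod h / rho) by apply: Rdiv_le_0_compat; lra. lra. }
  have [N HN] := pow_lt_1_zero _ Habs _ (Rdiv_lt_0_compat _ _ He HA1).
  exists N => n Hn.
  have := HN n Hn.
  have HqN : 0 <= (Cmod h / rho) ^ n by apply: pow_le; lra.
  rewrite Rabs_pos_eq // => /(Rlt_div_r _ _ _ HA1) H1.
  apply: (Rle_lt_trans _ _ _ (Herr n)); nra.
Qed.

(** * The rotated Mordell-Appell integrals *)

(** The value at 0 fills the removable singularity, so that the kernel is continuous in [s] on the
    whole line. *)
Definition sinh_ratio (b c : R) (q : C) : C :=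
  if Ceq_dec q 0 then RtoC (b / c) else (Csinh (RtoC b * q) / Csinh (RtoC c * q))%C.

(* The substitution [u = s e^(be w)] turns the Gaussian factor into
   [exp (- p s^2 e^((2 be - 1) w))]: [be = 0] is the original integral, and
   [be = 1/3] balances the two conditions [|be Im w| < pi/2] (no pole of the
   quotient is met) and [|(2 be - 1) Im w| < pi/2] (Gaussian decay), so that a
   single formula covers the whole sector of opening [3 pi]. *)
Definition MA_kernel (p b c be al : R) (w : C) (s : R) : C :=
  (Cexp (RtoC al * w) * Cexp (RtoC (- (p * s ^ 2)) * Cexp (RtoC (2 * be - 1) * w)) *
   sinh_ratio b c (RtoC s * Cexp (RtoC be * w)))%C.

Definition MA_int (p b c be al : R) (w : C) : C := Cint_0_oo (MA_kernel p b c be al w).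

Lemma sinh_ratio_0 b c : sinh_ratio b c 0 = RtoC (b / c).
Proof. by rewrite /sinh_ratio; case: (Ceq_dec 0 0). Qed.

Lemma sinh_ratio_n0 b c (q : C) : q <> 0 ->
  sinh_ratio b c q = (Csinh (RtoC b * q) / Csinh (RtoC c * q))%C.
Proof. by rewrite /sinh_ratio; case: (Ceq_dec q 0). Qed.

Lemma RtoC_neq0 (x : R) : x <> 0 -> RtoC x <> 0.
Proof. by move=> Hx /RtoC_inj. Qed.

Lemma Re_RtoC_Cexp (x : R) (w : C) : Re (Cexp (RtoC x * w)) = exp (x * Re w) * cos (x * Im w).
Proof. by rewrite -re_scal_l -im_scal_l. Qed.

Lemma cos_pos (x : R) : Rabs x < PI / 2 -> 0 < cos x.
Proof. by move=> /Rabs_lt_between H; apply: cos_gt_0; lra. Qed.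

Lemma cos_ge (x y : R) : Rabs x <= y -> y < PI / 2 -> cos y <= cos x.
Proof.
  move=> Hx Hy.
  have -> : cos x = cos (Rabs x).
  { by rewrite /Rabs; case: Rcase_abs => // _; rewrite cos_neg. }
  have := PI_RGT_0; have := Rabs_pos x => ? ?.
  by apply: cos_decr_1; lra.
Qed.

Lemma holo_ext U (f g : C -> C) : (forall z, f z = g z) -> holo U f -> holo U g.
Proof.
  move=> E [f' Hf]; exists f' => z Uz; have [[phi [P1 P2 P3]] Hc] := Hf z Uz.
  split=> //; exists phi; split=> //; apply: filter_imp P3 => w; by rewrite !E.
Qed.

Lemma Csinh_denominator_neq0 (c be : R) (s : R) (w : C) :
  0 < c -> s <> 0 -> Rabs (be * Im w) < PI / 2 ->
  Csinh (RtoC c * (RtoC s * Cexp (RtoC be * w))) <> 0.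
Proof.
  move=> Hc Hs Hw; apply: Csinh_neq0.
  rewrite !re_scal_l Re_RtoC_Cexp.
  have := cos_pos _ Hw; have := exp_pos (be * Re w) => H1 H2.
  by repeat apply: Rmult_integral_contrapositive_currified; lra.
Qed.

Lemma scaled_Cexp_neq0 (s : R) (z : C) : s <> 0 -> (RtoC s * Cexp z)%C <> 0.
Proof. by move=> Hs; apply: Cmult_neq_0; [exact: RtoC_neq0 | exact: Cexp_neq0]. Qed.

Lemma MA_kernel_holo p b c be al s (U : C -> Prop) : 0 < c ->
  (forall z, U z -> Rabs (be * Im z) < PI / 2) ->
  holo U (fun w => MA_kernel p b c be al w s).
Proof.
  move=> Hc HU.
  have Hlin (x : R) : holo U (fun w => Cexp (RtoC x * w)).
  { apply: holo_Cexp; apply: holo_mult; [exact: holo_const | exact: holo_id]. }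
  apply: holo_mult.
  { apply: holo_mult => //; apply: holo_Cexp; apply: holo_mult => //; exact: holo_const. }
  case: (Req_dec s 0) => [->|Hs].
  - apply: holo_ext (holo_const U (RtoC (b / c))) => z.
    by rewrite Cmult_0_l sinh_ratio_0.
  - apply: (holo_ext U (fun w => Csinh (RtoC b * (RtoC s * Cexp (RtoC be * w))) *
      / Csinh (RtoC c * (RtoC s * Cexp (RtoC be * w))))%C).
    { by move=> z; rewrite sinh_ratio_n0 //; exact: scaled_Cexp_neq0. }
    have Harg (x : R) : holo U (fun w => RtoC x * (RtoC s * Cexp (RtoC be * w)))%C.
    { apply: holo_mult; first exact: holo_const.
      by apply: holo_mult => //; exact: holo_const. }
    apply: holo_mult; first exact: holo_Csinh.
    apply: holo_Cinv; last exact: holo_Csinh.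
    by move=> z Uz; apply: Csinh_denominator_neq0 => //; exact: HU.
Qed.

Lemma cdiff_Csinh_0 : cdiff Csinh 0 1.
Proof.
  have H1 := cdiff_mult _ _ _ _ _ (cdiff_const (- (1))%C 0) (cdiff_id 0).
  have H2 := cdiff_comp Cexp _ _ _ _ H1 (cdiff_Cexp _).
  have H3 := cdiff_mult _ _ _ _ _ (cdiff_const (- (1))%C 0) H2.
  have H4 := cdiff_plus _ _ _ _ _ (cdiff_Cexp 0) H3.
  have [phi [P1 P2 P3]] := cdiff_mult _ _ _ _ _ H4 (cdiff_const (RtoC (/ 2)) 0).
  have Hsh (w : C) : Csinh w = ((Cexp w + - (1) * Cexp (- (1) * w)) * RtoC (/ 2))%C.
  { rewrite /Csinh; have -> : (- w = - (1) * w)%C by ring.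
    by ring. }
  exists phi; split=> //.
  - rewrite P2; have -> : (- (1) * 0 = 0)%C by ring.
    rewrite Cexp_0 RtoC_inv; last lra.
    by field; apply: RtoC_neq0; lra.
  - by apply: filter_imp P3 => w; rewrite !Hsh.
Qed.

Lemma ccont_Csinh (z : C) : ccont (T := C_UniformSpace) Csinh z.
Proof.
  apply: ccont_mult; last exact: ccont_const.
  apply: ccont_minus; first exact: ccont_Cexp.
  apply: (ccont_comp Copp Cexp); last exact: ccont_Cexp.
  by apply: ccont_opp; exact: ccont_id.
Qed.

(** At $s=0$ each hyperbolic sine is its slope function times $s$, the slopes being $bq$ and $cq$
    there. Their quotient is continuous and agrees nearby with [sinh_ratio], including the value
    $b/c$. *)
Lemma ccont_sinh_ratio b c (q : C) s : 0 < c -> 0 < Re q ->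
  ccont (fun s => sinh_ratio b c (RtoC s * q)) s.
Proof.
  move=> Hc Hq.
  have Hq0 : q <> 0 by move=> E; rewrite E /= in Hq; lra.
  case: (Req_dec s 0) => [->|Hs].
  - have Hd (x : R) : pdiff (fun s => Csinh (RtoC x * (RtoC s * q))) 0 (RtoC x * q)%C.
    { have Hin : pdiff (fun s => RtoC x * (RtoC s * q))%C 0 (RtoC x * q)%C.
      { by apply: pdiff_ext (pdiff_affine 0 (RtoC x * q)%C 0) => // t; ring. }
      have := pdiff_comp Csinh _ _ 1 _ Hin.
      have -> : (RtoC x * (RtoC 0 * q) = 0)%C by ring.
      move=> /(_ cdiff_Csinh_0); apply: pdiff_ext => //; ring. }
    have [f [f1 f2 f3]] := Hd b; have [g [g1 g2 g3]] := Hd c.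
    have Hcq : (RtoC c * q)%C <> 0 by apply: Cmult_neq_0 => //; apply: RtoC_neq0; lra.
    have Hg0 : g 0 <> 0 by rewrite g2.
    have Hs0 (x : R) : Csinh (RtoC x * (RtoC 0 * q)) = 0.
    { have -> : (RtoC x * (RtoC 0 * q) = RtoC 0)%C by ring.
      by rewrite Csinh_RtoC sinh_0. }
    apply: (ccont_ext_loc (fun s => f s * / g s)%C).
    + apply: filter_imp (filter_and _ _ f3 (filter_and _ _ g3 (ccont_neq0 _ _ g1 Hg0))).
      move=> t [E1 [E2 Hgt]].
      case: (Req_dec t 0) => [->|Ht].
      * rewrite Cmult_0_l sinh_ratio_0 f2 g2 RtoC_div; last lra.
        field; split=> //; apply: RtoC_neq0; lra.
      * rewrite sinh_ratio_n0; last by apply: Cmult_neq_0 => //; exact: RtoC_neq0.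
        rewrite !Hs0 Rminus_0_r in E1 E2.
        have -> : Csinh (RtoC b * (RtoC t * q)) = (f t * RtoC t)%C by rewrite -E1; ring.
        have -> : Csinh (RtoC c * (RtoC t * q)) = (g t * RtoC t)%C by rewrite -E2; ring.
        field; split=> //; exact: RtoC_neq0.
    + by apply: ccont_mult => //; apply: (ccont_comp g Cinv) => //; exact: ccont_Cinv.
  - have Hlin (x : R) : ccont (fun s => RtoC x * (RtoC s * q))%C s.
    { apply: ccont_mult; first exact: ccont_const.
      apply: ccont_mult; last exact: ccont_const.
      apply: ccont_RtoC; exact: continuous_id. }
    have Hsh (x : R) : ccont (fun s => Csinh (RtoC x * (RtoC s * q))) s.
    { by apply: (ccont_comp _ Csinh) => //; exact: ccont_Csinh. }
    apply: (ccont_ext_loc (fun s => Csinh (RtoC b * (RtoC s * q)) *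
      / Csinh (RtoC c * (RtoC s * q)))%C).
    + apply/locally_R; exists (Rabs s); split; first exact: Rabs_pos_lt.
      move=> t Ht; rewrite sinh_ratio_n0 //.
      apply: Cmult_neq_0 => //; apply: RtoC_neq0 => E; move: Ht; rewrite E.
      by rewrite Rminus_0_l Rabs_Ropp; lra.
    + apply: ccont_mult => //.
      apply: (ccont_comp (fun s => Csinh (RtoC c * (RtoC s * q))) Cinv) => //.
      apply: ccont_Cinv; apply: Csinh_neq0; rewrite !re_scal_l.
      by repeat apply: Rmult_integral_contrapositive_currified; lra.
Qed.

Lemma MA_kernel_ccont p b c be al w s : 0 < c -> Rabs (be * Im w) < PI / 2 ->
  ccont (MA_kernel p b c be al w) s.
Proof.
  move=> Hc Hw; apply: ccont_mult; last first.
  { apply: ccont_sinh_ratio => //; rewrite Re_RtoC_Cexp.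
    by apply: Rmult_lt_0_compat; [exact: exp_pos | exact: cos_pos]. }
  apply: ccont_mult; first exact: ccont_const.
  apply: (ccont_comp _ Cexp); last exact: ccont_Cexp.
  apply: ccont_mult; last exact: ccont_const.
  apply: ccont_RtoC; apply: (ex_derive_continuous (fun s => - (p * s ^ 2))).
  by auto_derive.
Qed.

(** [ka] bounds from below the cosine of the angle between [q] and the real axis, so that $|\sinh
    cq|\ge c|\Re q|\ge c\,\mathrm{ka}\,|q|$. The factor $|q|$ cancels against the one in the bound
    of the numerator. *)
Lemma sinh_ratio_le b c (q : C) (ka : R) : 0 < c -> 0 < ka <= 1 ->
  Cmod q * ka <= Rabs (Re q) ->
  Cmod (sinh_ratio b c q) <= 2 * Rabs b / (c * ka) * exp (Rabs b * Cmod q).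
Proof.
  move=> Hc Hka Hq.
  have Hb := Rabs_pos b.
  have Hck : 0 < c * ka by nra.
  case: (Ceq_dec q 0) => [->|Hq0].
  - rewrite sinh_ratio_0 Cmod_0 Rmult_0_r exp_0 Rmult_1_r Cmod_R Rabs_div; last lra.
    rewrite (Rabs_pos_eq c); last lra.
    have -> : 2 * Rabs b / (c * ka) = Rabs b / c * (2 / ka) by field; lra.
    have H1 : 0 <= Rabs b / c by apply: Rdiv_le_0_compat.
    have H2 : 1 <= 2 / ka by apply/Rle_div_r; lra.
    nra.
  - rewrite sinh_ratio_n0 //.
    have Hm : 0 < Cmod q by apply/Cmod_gt_0.
    have H1 := Csinh_le (RtoC b * q).
    have H2 := abs_Re_le_Csinh (RtoC c * q).
    rewrite Cmod_mult Cmod_R in H1.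
    rewrite re_scal_l Rabs_mult (Rabs_pos_eq c) in H2; last lra.
    have H3 : 0 < c * ka * Cmod q by nra.
    have H4 : c * ka * Cmod q <= Cmod (Csinh (RtoC c * q)) by nra.
    have H5 : Csinh (RtoC c * q) <> 0 by apply/Cmod_gt_0; lra.
    rewrite Cmod_div //.
    apply/Rle_div_l; first lra.
    apply: (Rle_trans _ _ _ H1).
    have -> : 2 * (Rabs b * Cmod q) * exp (Rabs b * Cmod q) =
      2 * Rabs b / (c * ka) * exp (Rabs b * Cmod q) * (c * ka * Cmod q) by field; lra.
    apply: Rmult_le_compat_l => //.
    apply: Rmult_le_pos; last by left; exact: exp_pos.
    by apply: Rdiv_le_0_compat; lra.
Qed.

Lemma abs_scal_le (x y X : R) : Rabs y <= X -> Rabs (x * y) <= Rabs x * X.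
Proof. by move=> H; rewrite Rabs_mult; apply: Rmult_le_compat_l => //; exact: Rabs_pos. Qed.

(** On the rectangle the quotient grows at most like $e^{B|s|}$, whatever the size of [b] relative
    to [c]. The Gaussian factor, bounded by $e^{-p\,\mathrm{de}\,s^2}$, absorbs this growth together
    with the requested $e^{-|s|}$. *)
Lemma MA_kernel_bound p b c be al (X Y : R) : 0 < p -> 0 < c -> 0 <= Y ->
  Rabs be * Y < PI / 2 -> Rabs (2 * be - 1) * Y < PI / 2 ->
  exists A, forall w s, Rabs (Re w) <= X -> Rabs (Im w) <= Y ->
    Cmod (MA_kernel p b c be al w s) <= A * exp (- Rabs s).
Proof.
  move=> Hp Hc HY Hbe Hga.
  set ga := 2 * be - 1.
  set ka := cos (Rabs be * Y).
  have Hka : 0 < ka <= 1.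
  { split; last by have := COS_bound (Rabs be * Y); rewrite -/ka; lra.
    apply: cos_pos; rewrite Rabs_pos_eq //.
    by apply: Rmult_le_pos => //; exact: Rabs_pos. }
  (* A lower bound of $\Re e^{\mathrm{ga}\,w}$ on the rectangle, positive by the condition on
     [ga]. *)
  set de := exp (- (Rabs ga * X)) * cos (Rabs ga * Y).
  have Hcg : 0 < cos (Rabs ga * Y).
  { apply: cos_pos; rewrite Rabs_pos_eq //.
    by apply: Rmult_le_pos => //; exact: Rabs_pos. }
  have Hde : 0 < de by apply: Rmult_lt_0_compat => //; exact: exp_pos.
  set E := exp (Rabs be * X).
  set B := Rabs b * E.
  set D := 2 * Rabs b / (c * ka).
  (* The maximum over $u$ of $(B+1)u-p\,\mathrm{de}\,u^2$. *)
  set T := (B + 1) ^ 2 / (4 * (p * de)).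
  have Hpd : 0 < p * de by nra.
  exists (exp (Rabs al * X) * exp T * D) => w s Hx Hy.
  rewrite /MA_kernel !Cmod_mult !Cmod_Cexp.
  have H1 : exp (Re (RtoC al * w)) <= exp (Rabs al * X).
  { apply: exp_le_compat; rewrite re_scal_l.
    by apply: (Rle_trans _ _ _ (Rle_abs _)); apply: abs_scal_le. }
  have H2 : exp (Re (RtoC (- (p * s ^ 2)) * Cexp (RtoC ga * w))) <= exp (- (p * de * s ^ 2)).
  { apply: exp_le_compat; rewrite re_scal_l Re_RtoC_Cexp.
    have G1 : exp (- (Rabs ga * X)) <= exp (ga * Re w).
    { apply: exp_le_compat; have := abs_scal_le ga _ _ Hx => /Rabs_le_between; lra. }
    have G2 : cos (Rabs ga * Y) <= cos (ga * Im w).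
    { by apply: cos_ge => //; apply: abs_scal_le. }
    have G3 : de <= exp (ga * Re w) * cos (ga * Im w).
    { apply: Rmult_le_compat => //; [left; exact: exp_pos | lra]. }
    have : 0 <= p * s ^ 2 by have := pow2_ge_0 s; nra.
    nra. }
  have Hq : Cmod (RtoC s * Cexp (RtoC be * w)) = Rabs s * exp (be * Re w).
  { by rewrite Cmod_mult Cmod_R Cmod_Cexp re_scal_l. }
  have H3 : Cmod (sinh_ratio b c (RtoC s * Cexp (RtoC be * w))) <= D * exp (B * Rabs s).
  { have Hk : ka <= cos (be * Im w) by apply: cos_ge => //; apply: abs_scal_le.
    apply: (Rle_trans _ _ _ (sinh_ratio_le b c _ ka Hc Hka _)).
    - rewrite Hq re_scal_l Re_RtoC_Cexp !Rabs_mult.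
      rewrite (Rabs_pos_eq (exp _)); last by left; exact: exp_pos.
      rewrite (Rabs_pos_eq (cos _)); last lra.
      rewrite -Rmult_assoc; apply: Rmult_le_compat_l => //.
      by apply: Rmult_le_pos; [exact: Rabs_pos | left; exact: exp_pos].
    - apply: Rmult_le_compat_l.
      { by apply: Rdiv_le_0_compat; [have := Rabs_pos b; lra | nra]. }
      apply: exp_le_compat; rewrite Hq /B.
      have G : exp (be * Re w) <= E.
      { apply: exp_le_compat; apply: (Rle_trans _ _ _ (Rle_abs _)); exact: abs_scal_le. }
      have -> : Rabs b * (Rabs s * exp (be * Re w)) = Rabs b * Rabs s * exp (be * Re w) by ring.
      have -> : Rabs b * E * Rabs s = Rabs b * Rabs s * E by ring.
      apply: Rmult_le_compat_l => //.
      by apply: Rmult_le_pos; exact: Rabs_pos. }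
  have H4 : exp (- (p * de * s ^ 2)) * exp (B * Rabs s) <= exp T * exp (- Rabs s).
  { rewrite -!exp_plus; apply: exp_le_compat.
    rewrite -(pow2_abs s).
    have HT : T * (4 * (p * de)) = (B + 1) ^ 2 by rewrite /T; field; lra.
    move: HT Hpd; move: (p * de) (Rabs s) => k u HT Hk.
    have Hsq : 0 <= (2 * k * u - (B + 1)) ^ 2 by apply: pow2_ge_0.
    apply: (Rmult_le_reg_l (4 * k)); first lra.
    have -> : 4 * k * (T + - u) = T * (4 * k) - 4 * k * u by ring.
    rewrite HT; nra. }
  have HD : 0 <= D.
  { by apply: Rdiv_le_0_compat; [have := Rabs_pos b; lra | nra]. }
  apply: (Rle_trans _ (exp (Rabs al * X) * exp (- (p * de * s ^ 2)) * (D * exp (B * Rabs s)))).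
  - apply: Rmult_le_compat => //.
    + by apply: Rmult_le_pos; left; exact: exp_pos.
    + exact: Cmod_ge_0.
    + by apply: Rmult_le_compat => //; left; exact: exp_pos.
  - have -> : exp (Rabs al * X) * exp (- (p * de * s ^ 2)) * (D * exp (B * Rabs s)) =
      exp (Rabs al * X) * D * (exp (- (p * de * s ^ 2)) * exp (B * Rabs s)) by ring.
    have -> : exp (Rabs al * X) * exp T * D * exp (- Rabs s) =
      exp (Rabs al * X) * D * (exp T * exp (- Rabs s)) by ring.
    apply: Rmult_le_compat_l => //.
    by apply: Rmult_le_pos => //; left; exact: exp_pos.
Qed.

(** * The kernel integrals as analytic functions on a strip *)

Section MAint.
Context (p b c be Y : R).
Context (p_gt0 : 0 < p) (c_gt0 : 0 < c).
Context (be_Y : Rabs be * Y <= PI / 2).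
Context (ga_Y : Rabs (2 * be - 1) * Y <= PI / 2).

(** Bounds that may be equalities at the edge [Y] are strict inside, so that [Y] can be the full
    half-opening. *)
Lemma abs_mult_lt (x y : R) : Rabs x * Y <= PI / 2 -> 0 <= y < Y -> Rabs x * y < PI / 2.
Proof.
  move=> Hx Hy; have HPI := PI_RGT_0.
  case: (Req_dec (Rabs x) 0) => [->|Hx0]; first lra.
  have := Rabs_pos x; nra.
Qed.

Lemma strip_be (w : C) : Rabs (Im w) < Y -> Rabs (be * Im w) < PI / 2.
Proof.
  move=> Hw; rewrite Rabs_mult; apply: abs_mult_lt => //.
  by split=> //; exact: Rabs_pos.
Qed.

Lemma MA_int_spec al w : Rabs (Im w) < Y ->
  is_CInt_oo (MA_kernel p b c be al w) (MA_int p b c be al w).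
Proof.
  move=> Hw; have Hw0 := Rabs_pos (Im w).
  have [||A HA] := MA_kernel_bound p b c be al (Rabs (Re w)) (Rabs (Im w)) p_gt0 c_gt0 Hw0.
  - exact: abs_mult_lt.
  - exact: abs_mult_lt.
  have [|s Hs|l [Hl _]] := dominated_CInt_oo (MA_kernel p b c be al w) A.
  - by move=> s; apply: MA_kernel_ccont => //; exact: strip_be.
  - by have := HA w s (Rle_refl _) (Rle_refl _); rewrite (Rabs_pos_eq s).
  - by rewrite /MA_int (is_CInt_oo_unique _ _ Hl).
Qed.

Lemma MA_int_analytic al w : Rabs (Im w) < Y -> analytic_at (MA_int p b c be al) w.
Proof.
  move=> Hw; have Hw0 := Rabs_pos (Im w).
  (* An eighth of the distance to the edge of the strip: the disc of radius [4 * rho] stays at least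
     half that distance away from it. *)
  pose rho := (Y - Rabs (Im w)) / 8.
  have Hrho : 0 < rho by rewrite /rho; lra.
  have HY1 : 0 <= Rabs (Im w) + 4 * rho by lra.
  have HY2 : Rabs (Im w) + 4 * rho < Y by rewrite /rho; lra.
  have HIm (z : C) d : Cmod (z - w) <= d -> Rabs (Im z) <= Rabs (Im w) + d.
  { move=> Hz; have := im_le_Cmod (z - w); rewrite im_plus im_opp => H.
    have := Rabs_triang (Im z + - Im w) (Im w).
    have -> : Im z + - Im w + Im w = Im z by ring.
    lra. }
  have HRe (z : C) d : Cmod (z - w) <= d -> Rabs (Re z) <= Rabs (Re w) + d.
  { move=> Hz; have := re_le_Cmod (z - w); rewrite re_plus re_opp => H.
    have := Rabs_triang (Re z + - Re w) (Re w).
    have -> : Re z + - Re w + Re w = Re z by ring.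
    lra. }
  have [||A HA] := MA_kernel_bound p b c be al (Rabs (Re w) + rho)
    (Rabs (Im w) + 4 * rho) p_gt0 c_gt0 HY1.
  - exact: abs_mult_lt.
  - exact: abs_mult_lt.
  apply: (analytic_integral _ w rho A) => //.
  - move=> s; apply: MA_kernel_holo => // z Hz; apply: strip_be.
    by have := HIm z (4 * rho) (Rlt_le _ _ Hz); lra.
  - move=> z s Hz; apply: MA_kernel_ccont => //; apply: strip_be.
    by have := HIm z rho Hz; lra.
  - move=> z s Hz; apply: HA; first exact: HRe.
    by have := HIm z rho Hz; lra.
Qed.

Lemma MA_int_twist al al' w : Rabs (Im w) < Y ->
  MA_int p b c be (al + al') w = (Cexp (RtoC al * w) * MA_int p b c be al' w)%C.
Proof.
  move=> Hw; apply: is_CInt_oo_unique.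
  apply: is_CInt_oo_ext (is_CInt_oo_scal (Cexp (RtoC al * w)) _ _ (MA_int_spec al' w Hw)).
  move=> s _; rewrite /MA_kernel RtoC_plus Cmult_plus_distr_r Cexp_plus; ring.
Qed.

End MAint.

Lemma is_CInt_oo_dilate (y : R) f l : 0 < y ->
  is_CInt_oo f l -> is_CInt_oo (fun s => RtoC y * f (Rmult y s))%C l.
Proof.
  move=> Hy Hf eps He; have [S0 H] := Hf eps He.
  exists (S0 / y) => S HS.
  have [|z [Hz1 Hz2]] := H (y * S).
  { by move: HS => /Rlt_div_l; rewrite Rmult_comm; apply. }
  exists z; split=> //.
  have := is_RInt_comp_lin (V := C_R_NormedModule) f y 0 0 S z.
  rewrite Rmult_0_r !Rplus_0_r => /(_ Hz1).
  apply: is_RInt_ext => s _.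
  by rewrite scal_R_Cmult Rplus_0_r.
Qed.

(** This is the dilation of the variable by $e^{\mathrm{be}\,u}$, whose Jacobian raises the weight
    from [al] to [al + be]. *)
Lemma MA_int_rotate_real p b c be al (u : R) : 0 < p -> 0 < c ->
  MA_int p b c be (al + be) (RtoC u) = MA_int p b c 0 al (RtoC u).
Proof.
  move=> Hp Hc; have HPI := PI_RGT_0.
  apply: is_CInt_oo_unique.
  have Hspec : is_CInt_oo (MA_kernel p b c 0 al (RtoC u)) (MA_int p b c 0 al (RtoC u)).
  (* The point is real, and 1 is an arbitrary half-width below $\pi/2$. *)
  { apply: (MA_int_spec p b c 0 1) => //.
    - rewrite Rabs_R0; lra.
    - rewrite Rmult_0_r Rminus_0_l Rabs_Ropp Rabs_R1; have := PI2_1; lra.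
    - rewrite /= Rabs_R0; lra. }
  apply: is_CInt_oo_ext (is_CInt_oo_dilate (exp (be * u)) _ _ (exp_pos _) Hspec) => s _.
  rewrite /MA_kernel -!RtoC_mult !Cexp_RtoC -!RtoC_mult !Cexp_RtoC.
  rewrite Rmult_0_l exp_0 Rmult_1_r (Rmult_comm s) Rmult_plus_distr_r exp_plus.
  have -> : - (p * (exp (be * u) * s) ^ 2) * exp ((2 * 0 - 1) * u) =
    - (p * s ^ 2) * exp ((2 * be - 1) * u).
  { have -> : (2 * be - 1) * u = be * u + be * u + (2 * 0 - 1) * u by ring.
    rewrite !exp_plus; ring. }
  by rewrite !RtoC_mult; ring.
Qed.

Lemma MA_int_rotate p b c al w : 0 < p -> 0 < c -> Rabs (Im w) < PI / 2 ->
  MA_int p b c (/ 3) (al + / 3) w = MA_int p b c 0 al w.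
Proof.
  move=> Hp Hc; have HPI := PI_RGT_0.
  apply: (identity_strip (MA_int p b c (/ 3) (al + / 3))).
  - move=> z Hz; apply: (MA_int_analytic p b c (/ 3) (PI / 2)) => //.
    + by rewrite Rabs_pos_eq; lra.
    + by rewrite Rabs_left; lra.
  - move=> z Hz; apply: (MA_int_analytic p b c 0 (PI / 2)) => //.
    + by rewrite Rabs_R0; lra.
    + by rewrite Rabs_left; lra.
  - by move=> u; apply: MA_int_rotate_real.
Qed.

(** * Continuation of Mordell-Appell functions *)

(* The weight [al] records a factor [t^al], so that no product of analytic
   functions has to be formed. *)
Definition weighted_continuation (g : C -> C) (Psi : R -> C -> C) : Prop :=
  [/\ forall al w, Rabs (Im w) < 3 * PI / 2 -> analytic_at (Psi al) w,
      forall al al' w, Rabs (Im w) < 3 * PI / 2 ->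
        Psi (al + al') w = (Cexp (RtoC al * w) * Psi al' w)%C &
      forall al w, Rabs (Im w) < PI / 2 ->
        Psi al w = (Cexp (RtoC al * w) * g (Cexp w))%C].

Lemma Cinv_Cexp (w : C) : (/ Cexp w)%C = Cexp (- w).
Proof.
  have H : (Cexp (- w) * Cexp w = 1)%C.
  { rewrite -Cexp_plus; have -> : (- w + w = 0)%C by ring. exact: Cexp_0. }
  have Hn := Cexp_neq0 w.
  have -> : Cexp (- w) = (Cexp (- w) * Cexp w * / Cexp w)%C by field.
  by rewrite H; ring.
Qed.

Lemma sinh_ratio_RtoC (b c s : R) : 0 < c -> 0 < s ->
  sinh_ratio b c (RtoC s) = RtoC (sinh (b * s) / sinh (c * s)).
Proof.
  move=> Hc Hs; rewrite sinh_ratio_n0; last by apply: RtoC_neq0; lra.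
  rewrite -!RtoC_mult !Csinh_RtoC RtoC_div //.
  have Hcs : 0 < c * s by nra.
  have := abs_le_sinh (c * s); rewrite (Rabs_pos_eq (c * s)); last lra.
  by move=> H E; rewrite E Rabs_R0 in H; lra.
Qed.

Lemma MA_kernel_0 (p b c al s : R) (w : C) : 0 < c -> 0 < s ->
  MA_kernel p b c 0 al w s =
  (Cexp (RtoC al * w) * (Cexp (- RtoC (p * s ^ 2) / Cexp w) *
   RtoC (sinh (b * s) / sinh (c * s))))%C.
Proof.
  move=> Hc Hs; rewrite /MA_kernel Cmult_0_l Cexp_0 Cmult_1_r sinh_ratio_RtoC //.
  rewrite /Cdiv Cinv_Cexp RtoC_opp.
  have -> : (RtoC (2 * 0 - 1) * w = - w)%C.
  { have -> : 2 * 0 - 1 = - (1) by ring. rewrite RtoC_opp; ring. }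
  by ring.
Qed.

Lemma MA_int_0_spec p b c w : 0 < p -> 0 < c -> Rabs (Im w) < PI / 2 ->
  is_CInt_oo (fun s => Cexp (- RtoC (p * s ^ 2) / Cexp w) *
    RtoC (sinh (b * s) / sinh (c * s)))%C (MA_int p b c 0 0 w).
Proof.
  move=> Hp Hc Hw; have HPI := PI_RGT_0.
  have H : is_CInt_oo (MA_kernel p b c 0 0 w) (MA_int p b c 0 0 w).
  { apply: (MA_int_spec p b c 0 (PI / 2)) => //.
    - by rewrite Rabs_R0; lra.
    - by rewrite Rabs_left; lra. }
  apply: is_CInt_oo_ext H => s Hs.
  by rewrite MA_kernel_0 // Cmult_0_l Cexp_0 Cmult_1_l.
Qed.

Lemma MA_int_0_twist p b c al w : 0 < p -> 0 < c -> Rabs (Im w) < PI / 2 ->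
  MA_int p b c 0 (al - 1) w = (Cexp (RtoC al * w) * (/ Cexp w * MA_int p b c 0 0 w))%C.
Proof.
  move=> Hp Hc Hw; have HPI := PI_RGT_0.
  have -> : al - 1 = (al - 1) + 0 by ring.
  rewrite (MA_int_twist p b c 0 (PI / 2)) //.
  - rewrite Cinv_Cexp Cmult_assoc -Cexp_plus; congr (Cexp _ * _)%C.
    by rewrite RtoC_minus; ring.
  - by rewrite Rabs_R0; lra.
  - by rewrite Rabs_left; lra.
Qed.

(** In the weight, $-1$ is the prefactor $1/t$ and $1/3$ is the Jacobian of the substitution. *)
Lemma MA_int_continuation p b c (g : C -> C) : 0 < p -> 0 < c ->
  (forall w, Rabs (Im w) < PI / 2 -> g (Cexp w) = (/ Cexp w * MA_int p b c 0 0 w)%C) ->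
  weighted_continuation g (fun al => MA_int p b c (/ 3) (al - 1 + / 3)).
Proof.
  move=> Hp Hc Hg; have HPI := PI_RGT_0.
  (* Both products equal $\pi/2$: the half-opening $3\pi/2$ is reached exactly. *)
  have H1 : Rabs (/ 3) * (3 * PI / 2) <= PI / 2 by rewrite Rabs_pos_eq; lra.
  have H2 : Rabs (2 * / 3 - 1) * (3 * PI / 2) <= PI / 2 by rewrite Rabs_left; lra.
  split.
  - by move=> al w Hw; apply: (MA_int_analytic p b c (/ 3) (3 * PI / 2)).
  - move=> al al' w Hw.
    have -> : al + al' - 1 + / 3 = al + (al' - 1 + / 3) by ring.
    by apply: (MA_int_twist p b c (/ 3) (3 * PI / 2)).
  - by move=> al w Hw; rewrite MA_int_rotate // MA_int_0_twist // Hg.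
Qed.

Lemma weighted_continuation_plus g h Phi Psi :
  weighted_continuation g Phi -> weighted_continuation h Psi ->
  weighted_continuation (fun t => g t + h t)%C (fun al w => Phi al w + Psi al w)%C.
Proof.
  case=> g1 g2 g3 [h1 h2 h3]; split.
  - by move=> al w Hw; apply: analytic_plus; [exact: g1 | exact: h1].
  - by move=> al al' w Hw; rewrite g2 // h2 //; ring.
  - by move=> al w Hw; rewrite g3 // h3 //; ring.
Qed.

Lemma weighted_continuation_ext (g h : C -> C) Psi :
  (forall w, Rabs (Im w) < PI / 2 -> g (Cexp w) = h (Cexp w)) ->
  weighted_continuation g Psi -> weighted_continuation h Psi.
Proof.
  by move=> E [H1 H2 H3]; split=> // al w Hw; rewrite H3 // E.
Qed.

(** Multiplying numerator and denominator by $2\sinh(Ps)$ turns the denominator into $\sinh(2Ps)$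
    and the numerator into a sum of two hyperbolic sines. The integrals [JC] are thus covered by the
    kernel with [c = 2 * P], the Gaussian constant remaining [P]. *)
Lemma cosh_ratio (P a s : R) : 0 < P -> 0 < s ->
  cosh ((P - a) * s) / cosh (P * s) =
  sinh ((2 * P - a) * s) / sinh (2 * P * s) + sinh (a * s) / sinh (2 * P * s).
Proof.
  move=> HP Hs.
  have Hsinh : 0 < sinh (P * s).
  { have HPs : 0 < P * s by nra.
    have : exp (- (P * s)) < exp (P * s) by apply: exp_increasing; lra.
    rewrite /sinh; lra. }
  have Hcosh : 0 < cosh (P * s).
  { rewrite /cosh; have := exp_pos (P * s); have := exp_pos (- (P * s)); lra. }
  have Hs2 : sinh (2 * P * s) = 2 * sinh (P * s) * cosh (P * s).
  { have E1 : 2 * P * s = P * s + P * s by ring.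
    rewrite /sinh /cosh E1 Ropp_plus_distr !exp_plus; field. }
  have Hsum : sinh ((2 * P - a) * s) + sinh (a * s) = 2 * sinh (P * s) * cosh ((P - a) * s).
  { have E1 : (2 * P - a) * s = P * s + (P - a) * s by ring.
    have E2 : a * s = P * s + - ((P - a) * s) by ring.
    rewrite /sinh /cosh E1 E2 !Ropp_plus_distr Ropp_involutive !exp_plus; field. }
  rewrite -Rdiv_plus_distr Hsum Hs2; field; lra.
Qed.

Lemma basic_weighted_continuation g : basic_Mordell_Appell g ->
  exists Psi, weighted_continuation g Psi.
Proof.
  case=> P [a [HP [->|->]]].
  - exists (fun al => MA_int P (P - a) P (/ 3) (al - 1 + / 3)).
    apply: (MA_int_continuation P (P - a) P) => [//|//|w Hw].
    by rewrite /JS (is_CInt_oo_unique _ _ (MA_int_0_spec P (P - a) P w HP HP Hw)).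
  - have HP2 : 0 < 2 * P by lra.
    pose half b (t : C) : C := (/ t * Cint_0_oo (fun s => Cexp (- RtoC (P * s ^ 2) / t) *
      RtoC (sinh (b * s) / sinh (2 * P * s))))%C.
    have Hhalf b : weighted_continuation (half b)
      (fun al => MA_int P b (2 * P) (/ 3) (al - 1 + / 3)).
    { apply: (MA_int_continuation P b (2 * P)) => [//|//|w Hw].
      by rewrite /half (is_CInt_oo_unique _ _ (MA_int_0_spec P b (2 * P) w HP HP2 Hw)). }
    eexists.
    apply: weighted_continuation_ext (weighted_continuation_plus _ _ _ _
      (Hhalf (2 * P - a)) (Hhalf a)) => w Hw.
    have I1 := MA_int_0_spec P (2 * P - a) (2 * P) w HP HP2 Hw.
    have I2 := MA_int_0_spec P a (2 * P) w HP HP2 Hw.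
    have I12 : is_CInt_oo (fun s => Cexp (- RtoC (P * s ^ 2) / Cexp w) *
      RtoC (cosh ((P - a) * s) / cosh (P * s)))%C
      (MA_int P (2 * P - a) (2 * P) 0 0 w + MA_int P a (2 * P) 0 0 w)%C.
    { apply: is_CInt_oo_ext (is_CInt_oo_plus _ _ _ _ I1 I2) => s Hs.
      by rewrite cosh_ratio // RtoC_plus; ring. }
    rewrite /half /JC (is_CInt_oo_unique _ _ I1) (is_CInt_oo_unique _ _ I2).
    by rewrite (is_CInt_oo_unique _ _ I12); ring.
Qed.

(** With $w=2(x+iy)$ the radicand is $(e^x\cos y)^2$, and $\cos y>0$ because $|y|<\pi/4$. *)
Lemma Csqrt_Cexp (w : C) : Rabs (Im w) < PI / 2 -> Csqrt (Cexp w) = Cexp (RtoC (/ 2) * w).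
Proof.
  move=> Hw.
  rewrite /Csqrt Cmod_Cexp.
  have E : w = (RtoC (/ 2) * w + RtoC (/ 2) * w)%C.
  { rewrite -Cmult_plus_distr_r -RtoC_plus; have -> : / 2 + / 2 = 1 by field. ring. }
  set x := Re (RtoC (/ 2) * w); set y := Im (RtoC (/ 2) * w).
  have Ex : Re w = x + x by rewrite {1}E re_plus.
  have Ey : Im w = y + y by rewrite {1}E im_plus.
  have Hy : 0 < cos y.
  { apply: cos_pos; rewrite /y im_scal_l Rabs_mult Rabs_pos_eq; last lra.
    have := Rabs_pos (Im w); lra. }
  have Hex := exp_pos x.
  have Hr : sqrt ((exp (Re w) + Re (Cexp w)) / 2) = exp x * cos y.
  { rewrite /Cexp /Re /= -/(Re w) Ex Ey exp_plus cos_plus.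
    have := sin2_cos2 y; rewrite /Rsqr => Hsc.
    have -> : (exp x * exp x + exp x * exp x * (cos y * cos y - sin y * sin y)) / 2 =
      (exp x * cos y) * (exp x * cos y).
    { have -> : sin y * sin y = 1 - cos y * cos y by lra. field. }
    apply: sqrt_square; nra. }
  rewrite Hr /Cexp -/x -/y; congr pair.
  rewrite /Im /= -/(Im w) -/(Re w) Ex Ey exp_plus sin_plus; field; lra.
Qed.

Lemma Csum_scal n (c : C) (F : 'I_n -> C) : Csum (fun j => (c * F j)%C) = (c * Csum F)%C.
Proof.
  rewrite /Csum; elim: n F => [|n IH] F; first by rewrite !big_ord0; ring.
  by rewrite !big_ord_recl IH; ring.
Qed.

Lemma Csum_plus n (F G : 'I_n -> C) : Csum (fun j => (F j + G j)%C) = (Csum F + Csum G)%C.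
Proof.
  rewrite /Csum; elim: n F G => [|n IH] F G; first by rewrite !big_ord0; ring.
  by rewrite !big_ord_recl IH; ring.
Qed.

Lemma Csum_ext n (F G : 'I_n -> C) : (forall j, F j = G j) -> Csum F = Csum G.
Proof. by move=> E; apply: eq_bigr => j _. Qed.

(** The normalization $t^{1/2}$ becomes a shift of the weight by one half. *)
Lemma Mordell_Appell_continuation f : Mordell_Appell f ->
  exists Psi, weighted_continuation f Psi.
Proof.
  case=> k [c [g [Hg Hf]]].
  have [Phi HPhi] : exists Phi : 'I_k -> R -> C -> C, forall l, weighted_continuation (g l) (Phi l).
  { have H l := basic_weighted_continuation _ (Hg l).
    exists (fun l => proj1_sig (constructive_indefinite_description _ (H l))) => l.
    exact: proj2_sig (constructive_indefinite_description _ (H l)). }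
  exists (fun al w => Csum (fun l => c l * Phi l (Rplus al (Rinv 2)) w)%C); split.
  - move=> al w Hw; apply: (analytic_Csum k (fun l z => c l * Phi l (Rplus al (Rinv 2)) z)%C) => l.
    by apply: analytic_scal; case: (HPhi l) => H _ _; exact: H.
  - move=> al al' w Hw; rewrite -Csum_scal; apply: Csum_ext => l.
    case: (HPhi l) => _ H _.
    by rewrite Rplus_assoc H //; ring.
  - move=> al w Hw.
    have Hre : 0 < Re (Cexp w).
    { by apply: Rmult_lt_0_compat; [exact: exp_pos | exact: cos_pos]. }
    rewrite Hf // Csqrt_Cexp // -!Csum_scal; apply: Csum_ext => l.
    case: (HPhi l) => _ _ H.
    by rewrite H // RtoC_plus Cmult_plus_distr_r Cexp_plus; ring.
Qed.

(** Existence of one continuation gives the [epsilon] choice its specification; agreement with [f]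
    on the real axis and the identity theorem then determine its values. *)
Lemma sector_continuation_eq f Psi w : weighted_continuation f Psi ->
  Rabs (Im w) < 3 * PI / 2 -> sector_continuation f w = Psi 0 w.
Proof.
  case=> H1 _ H3 Hw; have HPI := PI_RGT_0.
  have HPsi : sector_continuation_of f (Psi 0).
  { split=> [z Hz|z Hz]; first exact: H1.
    by rewrite H3 // Cmult_0_l Cexp_0 Cmult_1_l. }
  have [S1 S2] : sector_continuation_of f (sector_continuation f).
  { by apply: epsilon_spec; exists (Psi 0). }
  apply: (identity_strip _ _ _ _ S1) Hw; first by move=> z; exact: H1.
  move=> u; have Hu : Rabs (Im (RtoC u)) < PI / 2 by rewrite /= Rabs_R0; lra.
  by rewrite S2 //; case: HPsi => _ ->.
Qed.

(** * The S-relation between lateral values on the Stokes line *)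

Theorem proposition5p5 (m n : nat) (L : 'I_m -> C -> C) (Lt : 'I_n -> C -> C)
  (M : 'I_m -> 'I_n -> C)
  (HL : Mordell_Appell_vector L) (HLt : Mordell_Appell_vector Lt)
  (HS : forall (i : 'I_m) (t : R), 0 < t ->
     L i (RtoC t) =
     (RtoC (sqrt (PI / t)) * matvec M (fun j => Lt j (RtoC (PI ^ 2 / t))) i)%C) :
  forall (i : 'I_m) (t : R), t < 0 ->
    median_value (L i) t =
    (Ci * RtoC (sqrt (PI / - t)) *
     matvec M (fun j => Stokes_jump (Lt j) (PI ^ 2 / t)) i)%C.
Proof.
  move=> i t Ht; have HPI := PI_RGT_0.
  have [Phi HPhi] := Mordell_Appell_continuation _ (HL i).
  have [Psi HPsi] : exists Psi : 'I_n -> R -> C -> C,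
    forall j, weighted_continuation (Lt j) (Psi j).
  { have H j := Mordell_Appell_continuation _ (HLt j).
    exists (fun j => proj1_sig (constructive_indefinite_description _ (H j))) => j.
    exact: proj2_sig (constructive_indefinite_description _ (H j)). }
  pose k : C := RtoC (2 * ln PI).
  have HIm z : Im (k - z) = - Im z by rewrite im_plus im_opp /=; ring.
  have Hsqrt (u : R) : sqrt (PI / exp u) = sqrt PI * exp (- (/ 2 * u)).
  { have -> : PI / exp u = PI * (exp (- (/ 2 * u)) * exp (- (/ 2 * u))).
    { rewrite -exp_plus; have -> : - (/ 2 * u) + - (/ 2 * u) = - u by field.
      by rewrite exp_Ropp. }
    rewrite sqrt_mult; [|lra|by apply: Rmult_le_pos; left; exact: exp_pos].
    by rewrite sqrt_square //; left; exact: exp_pos. }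
  (* The S-relation multiplied by [t^(1/2)] continues from the real axis. *)
  have Hrel w : Rabs (Im w) < 3 * PI / 2 ->
    Phi (/ 2) w = (RtoC (sqrt PI) * Csum (fun j => M i j * Psi j (IZR 0) (k - w)))%C.
  { have [P1 _ P3] := HPhi.
    apply: (identity_strip (Phi (/ 2))
      (fun w => RtoC (sqrt PI) * Csum (fun j => M i j * Psi j (IZR 0) (k - w)))%C).
    - by move=> z; exact: P1.
    - move=> z Hz; apply: analytic_scal.
      apply: (analytic_Csum n (fun j z => M i j * Psi j (IZR 0) (k - z))%C) => j.
      apply: analytic_scal; apply: (analytic_reflect (Psi j 0)).
      case: (HPsi j) => Q1 _ _; apply: Q1.
      by rewrite HIm Rabs_Ropp.
    - move=> u.
      have Hu (v : R) : Rabs (Im (RtoC v)) < PI / 2 by rewrite /= Rabs_R0; lra.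
      rewrite P3 // !Cexp_RtoC HS; last exact: exp_pos.
      rewrite -RtoC_mult Cexp_RtoC Hsqrt Cmult_assoc -RtoC_mult.
      have -> : exp (/ 2 * u) * (sqrt PI * exp (- (/ 2 * u))) = sqrt PI.
      { have E : exp (/ 2 * u) * exp (- (/ 2 * u)) = 1 by rewrite -exp_plus Rplus_opp_r exp_0.
        by rewrite (Rmult_comm (sqrt PI)) -Rmult_assoc E Rmult_1_l. }
      congr (_ * _)%C; apply: Csum_ext => j; congr (_ * _)%C.
      case: (HPsi j) => _ _ Q3.
      rewrite /k -RtoC_minus Q3 // Cmult_0_l Cexp_0 Cmult_1_l Cexp_RtoC; congr (Lt j (RtoC _)).
      rewrite /Rminus exp_plus exp_Ropp.
      have -> : 2 * ln PI = ln PI + ln PI by ring.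
      rewrite exp_plus exp_ln //; rewrite /Rdiv /=; ring. }
  have Ht' : 0 < - t by lra.
  pose lt := ln (- t).
  pose x' := ln (- (PI ^ 2 / t)).
  have Hln : x' = 2 * ln PI - lt.
  { rewrite /x'; have -> : - (PI ^ 2 / t) = PI * PI / - t by field; lra.
    rewrite ln_div //; last by nra.
    by rewrite ln_mult // -/lt; ring. }
  have Hlat (y : R) : Rabs y = PI ->
    Rabs (Im ((lt, y) : C)) < 3 * PI / 2 by move=> /= ->; lra.
  (* The reflection sends $\ln|t|+iy$ to $x'-iy$, where $x'=\ln|\pi^2/t|$: a lateral value of [L i]
     is expressed through the opposite lateral values of the [Lt j]. *)
  have Hval (y : R) : Rabs y = PI ->
    sector_continuation (L i) (lt, y) =
    (Cexp (RtoC (Ropp (Rinv 2)) * (lt, y)) * (RtoC (sqrt PI) *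
      Csum (fun j => M i j * sector_continuation (Lt j) (x', Ropp y))))%C.
  { move=> Hy; rewrite (sector_continuation_eq _ _ _ HPhi (Hlat y Hy)).
    have [_ P2 _] := HPhi.
    (* Weight 0 is split as $-\frac12+\frac12$, to divide out the factor $t^{1/2}$ that the
       continued relation carries. *)
    have -> : Phi 0 (lt, y) = Phi (- / 2 + / 2) (lt, y).
    { by congr (Phi _ _); ring. }
    rewrite P2; last exact: Hlat.
    rewrite Hrel; last exact: Hlat.
    congr (_ * (_ * _))%C; apply: Csum_ext => j; congr (_ * _)%C.
    have Ek : Cminus k (lt, y) = (x', - y).
    { by rewrite Hln /k /RtoC /Cminus /Cplus /Copp /=; congr pair; ring. }
    rewrite Ek (sector_continuation_eq _ _ _ (HPsi j)) //=.
    by rewrite Rabs_Ropp Hy; lra. }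
  have Hroot : RtoC (sqrt (PI / - t)) = RtoC (exp (- (/ 2 * lt)) * sqrt PI).
  { by rewrite -{1}(exp_ln (- t)) // Hsqrt Rmult_comm. }
  have Hphase (y : R) : cos (/ 2 * y) = 0 ->
    Cexp (RtoC (Ropp (Rinv 2)) * (lt, y)) =
    (RtoC (exp (- (/ 2 * lt))) * (- (RtoC (sin (/ 2 * y)) * Ci)))%C.
  { move=> Hc; rewrite /Cexp re_scal_l im_scal_l /=.
    have -> : - / 2 * lt = - (/ 2 * lt) by ring.
    have -> : - / 2 * y = - (/ 2 * y) by ring.
    rewrite cos_neg sin_neg Hc /RtoC /Ci /Cmult /Copp /=; congr pair; ring. }
  have Ehalf : / 2 * PI = PI / 2 by field.
  have Ehalf' : / 2 * - PI = - (PI / 2) by field.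
  have Hup : Cexp (RtoC (Ropp (Rinv 2)) * (lt, PI)) =
    (RtoC (exp (- (/ 2 * lt))) * - Ci)%C.
  { by rewrite Hphase Ehalf ?cos_PI2 // sin_PI2; congr (_ * _)%C; ring. }
  have Hlow : Cexp (RtoC (Ropp (Rinv 2)) * (lt, Ropp PI)) =
    (RtoC (exp (- (/ 2 * lt))) * Ci)%C.
  { rewrite Hphase Ehalf' ?cos_neg ?cos_PI2 // sin_neg sin_PI2 RtoC_opp.
    by congr (_ * _)%C; ring. }
  rewrite /median_value /upper_lateral /lower_lateral.
  rewrite Hval; last by rewrite Rabs_pos_eq; lra.
  rewrite Hval; last by rewrite Rabs_Ropp Rabs_pos_eq; lra.
  rewrite Ropp_involutive Hup Hlow Hroot RtoC_mult /matvec.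
  (* The factor $-i$ stands with the lower values of the [Lt j] and $i$ with the upper ones, which
     gives the jump with its sign, upper minus lower. *)
  have -> : Csum (fun j => M i j * Stokes_jump (Lt j) (PI ^ 2 / t))%C =
    ((Csum (fun j => M i j * sector_continuation (Lt j) (x', PI)) +
      - (1) * Csum (fun j => M i j * sector_continuation (Lt j) (x', Ropp PI))) * / 2)%C.
  { rewrite -Csum_scal -Csum_plus Cmult_comm -Csum_scal; apply: Csum_ext => j.
    rewrite /Stokes_jump /upper_lateral /lower_lateral -/x'.
    by field. }
  by field.
Qed.
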